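(* Let $a,b,c\in\mathbb{C}$ satisfy $ab\ne0$ and $c\ne0,-1,-2,\dots$. The shifted hypergeometric function $z\,{}_2F_1(a,b;c;z)$ is starlike if the following conditions are satisfied: (i) $p=a+b+1-c$ is a real number; (ii) $\operatorname{Re}[ab]>p$; (iii) $L\ge0$, $N\ge0$ and $LN-M^2\ge0$, where \begin{align*} L&=|c-1|^2-|a+b|^2+p+3\operatorname{Re}[ab],\\ M&=\operatorname{Im}[ab(\bar a+\bar b-2)],\\ N&=|c-2|^2-|a-1|^2|b-1|^2-p+\operatorname{Re}[ab]. \end{align*}
   Context: $\mathbb{D}=\{z\in\mathbb{C}:|z|<1\}$. For $a,b,c\in\mathbb{C}$ with $c\ne0,-1,-2,\dots$, the Gaussian hypergeometric function is ${}_2F_1(a,b;c;z)=\sum_{n=0}^\infty\frac{(a)_n(b)_n}{(c)_n n!}z^n$ for $z\in\mathbb{D}$, where $(a)_0=1$ and $(a)_n=a(a+1)\cdots(a+n-1)$. An analytic function $f$ on $\mathbb{D}$ with $f(0)=0$, $f'(0)=1$ is called starlike if $\operatorname{Re}\left(\frac{zf'(z)}{f(z)}\right)>0$ for all $z\in\mathbb{D}$ (the quotient taking the value $1$ at $z=0$). *)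

(* Defs.v *)
From Stdlib Require Import Reals Factorial.
From Coquelicot Require Import Coquelicot.

Open Scope C_scope.

Definition in_disk (z : C) : Prop := (Cmod z < 1)%R.

Fixpoint pochhammer (a : C) (n : nat) : C :=
  match n with
  | O => 1
  | S m => pochhammer a m * (a + RtoC (INR m))
  end.

Definition hyp2F1_coef (a b c : C) (n : nat) : C :=
  pochhammer a n * pochhammer b n / (pochhammer c n * RtoC (INR (fact n))).

(* [iota] picks the sum of the series, which is unique when it exists;
   the value is only meaningful where the series converges, e.g. on the
   unit disk. *)
Definition hyp2F1 (a b c z : C) : C :=
  @iota C_CompleteNormedModule
    (fun l => @is_pseries C_AbsRing C_NormedModule (hyp2F1_coef a b c) z l).

Definition analytic_on_disk (f : C -> C) : Prop :=
  forall z : C, in_disk z -> @ex_derive C_AbsRing C_NormedModule f z.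

(* z f'(z) / f(z), with its removable singularity at 0 filled by 1. *)
Definition starlike_quotient (f : C -> C) (z : C) : C :=
  if Ceq_dec z 0 then 1 else z * C_derive f z / f z.

(* [C_derive] agrees with the complex derivative wherever the latter exists.
   The clause f z <> 0 makes explicit that the quotient is a genuine one,
   division being total here. *)
Definition starlike (f : C -> C) : Prop :=
  analytic_on_disk f /\ f 0 = 0 /\ C_derive f 0 = 1 /\
  (forall z : C, in_disk z -> z <> 0 -> f z <> 0) /\
  (forall z : C, in_disk z -> (0 < Re (starlike_quotient f z))%R).

(* In L and N the argument p is the real number a + b + 1 - c. *)
Definition condL (a b c : C) (p : R) : R :=
  (Cmod (c - 1) ^ 2 - Cmod (a + b) ^ 2 + p + 3 * Re (a * b)%C)%R.

Definition condM (a b : C) : R :=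
  Im (a * b * (Cconj a + Cconj b - 2)).

Definition condN (a b c : C) (p : R) : R :=
  (Cmod (c - 2) ^ 2 - Cmod (a - 1) ^ 2 * Cmod (b - 1) ^ 2
   - p + Re (a * b)%C)%R.

(* Main.v *)
(** Write F for the hypergeometric series and q = 1 + z F'/F. The function
    G = Re (conj F (zF)') equals |F|^2 Re q, so it is enough to show G > 0 on the disk.
    Otherwise let z0 be a point of least modulus with G(z0) <= 0; then Re q > 0 on
    |z| < |z0| and G(z0) = 0. There |zF| increases along rays, so F has no zero on
    |z| <= |z0|. The function g = - F' / (2 F + z F') satisfies z g = (1 - q) / (1 + q),
    hence |z g| <= 1 on the circle |z| = |z0|, with equality at z0, and the maximum
    principle makes z0 a maximum of |g| over the closed disk. Consequently zeta = z g'/g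
    is real and nonnegative at z0 (Jack's lemma), which means that q = i s and
    z q' = - (1 + zeta) (1 + s^2) / 2 there. The hypergeometric equation, written as a
    Riccati equation for q, has the form l = z0 r with
    |l|^2 - |r|^2 >= L s^2 - 2 M s + N >= 0, which forces l = r = 0 because |z0| < 1;
    but Re (l - r) = p - Re (a b) < 0. *)
Require Import Defs.
From Stdlib Require Import Reals.
From Coquelicot Require Import Coquelicot.
From Stdlib Require Import Lra Lia Psatz Factorial List Classical ClassicalChoice.

Open Scope C_scope.

(** * Complex differentiability *)

Lemma Rabs_Re_le (x : C) : (Rabs (Re x) <= Cmod x)%R.
Proof. eapply Rle_trans; [apply Rmax_l | apply Rmax_Cmod]. Qed.

Lemma Rabs_Im_le (x : C) : (Rabs (Im x) <= Cmod x)%R.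
Proof. eapply Rle_trans; [apply Rmax_r | apply Rmax_Cmod]. Qed.

(** Only the centre 0 is compared with nearby points. Sums, products and inverses keep the property
    with explicit constants, which replaces limit arguments. *)
Definition lip0 (u : C -> C) : Prop :=
  exists M d : R, (0 <= M)%R /\ (0 < d)%R /\
    forall h : C, (Cmod h < d)%R -> (Cmod (u h - u 0) <= M * Cmod h)%R.

(* Caratheodory's form of the derivative, with a slope that is Lipschitz at 0. *)
Definition cderiv (f : C -> C) (z l : C) : Prop :=
  exists (phi : C -> C) (d : R), lip0 phi /\ phi 0 = l /\ (0 < d)%R /\
    forall h : C, (Cmod h < d)%R -> f (z + h) = f z + h * phi h.

Lemma lip0_const (k : C) : lip0 (fun _ => k).
Proof.
exists 0%R, 1%R; repeat split; try lra.
intros h _; replace (k - k) with (RtoC 0) by ring; rewrite Cmod_0; lra.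
Qed.

Lemma lip0_id : lip0 (fun h => h).
Proof.
exists 1%R, 1%R; repeat split; try lra.
intros h _; replace (h - 0) with h by ring; lra.
Qed.

Lemma lip0_ext (u v : C -> C) (d : R) :
  (0 < d)%R -> (forall h, (Cmod h < d)%R -> u h = v h) -> lip0 u -> lip0 v.
Proof.
intros hd e (M & d' & hM & hd' & H).
exists M, (Rmin d d'); repeat split; auto.
- now apply Rmin_pos.
- intros h hh.
  rewrite <- (e h), <- (e 0).
  + apply H; eapply Rlt_le_trans; [exact hh | apply Rmin_r].
  + rewrite Cmod_0; exact hd.
  + eapply Rlt_le_trans; [exact hh | apply Rmin_l].
Qed.

Lemma lip0_plus (u v : C -> C) :
  lip0 u -> lip0 v -> lip0 (fun h => u h + v h).
Proof.
intros (M & d & hM & hd & H) (M' & d' & hM' & hd' & H').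
exists (M + M')%R, (Rmin d d'); repeat split; try lra.
- now apply Rmin_pos.
- intros h hh.
  assert (h1 := H h (Rlt_le_trans _ _ _ hh (Rmin_l _ _))).
  assert (h2 := H' h (Rlt_le_trans _ _ _ hh (Rmin_r _ _))).
  replace (u h + v h - (u 0 + v 0)) with ((u h - u 0) + (v h - v 0)) by ring.
  eapply Rle_trans; [apply Cmod_triangle |]; lra.
Qed.

Lemma lip0_mult (u v : C -> C) :
  lip0 u -> lip0 v -> lip0 (fun h => u h * v h).
Proof.
intros (M & d & hM & hd & H) (M' & d' & hM' & hd' & H').
(* The constant comes from splitting the increment as u h (v h - v 0) + v 0 (u h - u 0); the radius
   is at most 1 so that |u h| <= |u 0| + M. *)
exists ((Cmod (u 0%C) + M) * M' + Cmod (v 0%C) * M)%R, (Rmin 1 (Rmin d d')).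
assert (p1 := Cmod_ge_0 (u 0)); assert (p2 := Cmod_ge_0 (v 0)).
repeat split.
- apply Rplus_le_le_0_compat; apply Rmult_le_pos; lra.
- repeat apply Rmin_pos; lra.
- intros h hh.
  assert (k1 := Rmin_l 1 (Rmin d d')); assert (k2 := Rmin_r 1 (Rmin d d')).
  assert (k3 := Rmin_l d d'); assert (k4 := Rmin_r d d').
  assert (h1 := H h ltac:(lra)); assert (h2 := H' h ltac:(lra)).
  assert (p3 := Cmod_ge_0 h).
  replace (u h * v h - u 0 * v 0)
    with (u h * (v h - v 0) + v 0 * (u h - u 0)) by ring.
  eapply Rle_trans; [apply Cmod_triangle |].
  rewrite !Cmod_mult.
  assert (h3 : (Cmod (u h) <= Cmod (u 0%C) + M)%R).
  { replace (u h) with (u 0 + (u h - u 0)) by ring.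
    eapply Rle_trans; [apply Cmod_triangle |]; nra. }
  assert (p4 := Cmod_ge_0 (u h)); assert (p5 := Cmod_ge_0 (v h - v 0)).
  assert (Cmod (u h) * Cmod (v h - v 0) <= (Cmod (u 0%C) + M) * (M' * Cmod h))%R
    by (apply Rmult_le_compat; lra).
  assert (Cmod (v 0%C) * Cmod (u h - u 0) <= Cmod (v 0%C) * (M * Cmod h))%R
    by (apply Rmult_le_compat_l; lra).
  lra.
Qed.

Lemma lip0_away_from_zero (u : C -> C) :
  lip0 u -> u 0 <> 0 ->
  exists d, (0 < d)%R /\
    forall h, (Cmod h < d)%R -> (Cmod (u 0%C) / 2 <= Cmod (u h))%R.
Proof.
intros (M & d & hM & hd & H) h0.
assert (p := Cmod_gt_0 (u 0)); apply p in h0.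
(* Within this radius [u] varies by at most |u 0| / 2; M + 1 in place of M keeps the denominator
   positive. *)
exists (Rmin d (Cmod (u 0%C) / (2 * (M + 1)))); split.
- apply Rmin_pos; [lra | apply Rdiv_lt_0_compat; lra].
- intros h hh.
  assert (h1 := H h (Rlt_le_trans _ _ _ hh (Rmin_l _ _))).
  assert (h2 := Rlt_le_trans _ _ _ hh (Rmin_r _ _)).
  apply (Rmult_lt_compat_r (2 * (M + 1))) in h2; [| lra].
  unfold Rdiv in h2; rewrite Rmult_assoc, Rinv_l in h2; [| lra].
  assert (h3 := Cmod_triangle (u h) (- (u h - u 0))).
  replace (u h + - (u h - u 0)) with (u 0) in h3 by ring.
  rewrite Cmod_opp in h3; assert (q := Cmod_ge_0 h); nra.
Qed.

Lemma lip0_inv (u : C -> C) :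
  lip0 u -> u 0 <> 0 -> lip0 (fun h => / u h).
Proof.
intros hu h0; assert (hu' := hu).
destruct (lip0_away_from_zero u hu h0) as (d' & hd' & H').
destruct hu' as (M & d & hM & hd & H).
assert (p : (0 < Cmod (u 0%C))%R) by (now apply Cmod_gt_0).
set (m := Cmod (u 0%C)) in *.
(* The increment of 1/u is - (u h - u 0) / (u h u 0), where |u h| >= m / 2. *)
exists (2 * M / (m * m))%R, (Rmin d d'); repeat split.
- apply Rle_mult_inv_pos; nra.
- now apply Rmin_pos.
- intros h hh.
  assert (h1 := H h (Rlt_le_trans _ _ _ hh (Rmin_l _ _))).
  assert (h2 := H' h (Rlt_le_trans _ _ _ hh (Rmin_r _ _))).
  assert (nz : u h <> 0) by (apply Cmod_gt_0; lra).
  replace (/ u h - / u 0) with (- (u h - u 0) * / (u h * u 0))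
    by (field; split; assumption).
  rewrite Cmod_mult, Cmod_opp, Cmod_inv by (now apply Cmult_neq_0).
  rewrite Cmod_mult; fold m.
  replace (2 * M / (m * m) * Cmod h)%R
    with ((M * Cmod h) * / (m / 2 * m))%R by (field; lra).
  apply Rmult_le_compat; try apply Cmod_ge_0; auto.
  + left; apply Rinv_0_lt_compat; nra.
  + apply Rinv_le_contravar; nra.
Qed.

Lemma cderiv_lip0 (f : C -> C) (z l : C) :
  cderiv f z l -> lip0 (fun h => f (z + h)).
Proof.
intros (phi & d & hphi & _ & hd & H).
apply (lip0_ext (fun h => f z + h * phi h) _ d hd).
- intros h hh; now rewrite H.
- apply lip0_plus; [apply lip0_const | apply lip0_mult; [apply lip0_id | exact hphi]].
Qed.

Lemma cderiv_continuous (f : C -> C) (z l : C) (eps : R) :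
  cderiv f z l -> (0 < eps)%R ->
  exists d, (0 < d)%R /\
    forall w, (Cmod (w - z) < d)%R -> (Cmod (f w - f z) < eps)%R.
Proof.
intros hf he; destruct (cderiv_lip0 f z l hf) as (M & d & hM & hd & H).
exists (Rmin d (eps / (M + 1))); split.
- apply Rmin_pos; [lra | apply Rdiv_lt_0_compat; lra].
- intros w hw.
  assert (h1 := H _ (Rlt_le_trans _ _ _ hw (Rmin_l _ _))).
  assert (h2 := Rlt_le_trans _ _ _ hw (Rmin_r _ _)).
  apply (Rmult_lt_compat_r (M + 1)) in h2; [| lra].
  unfold Rdiv in h2; rewrite Rmult_assoc, Rinv_l in h2; [| lra].
  replace (z + (w - z)) with w in h1 by ring.
  replace (z + 0) with z in h1 by ring.
  assert (q := Cmod_ge_0 (w - z)); nra.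
Qed.

Lemma cderiv_const (k z : C) : cderiv (fun _ => k) z 0.
Proof.
exists (fun _ => 0), 1%R; repeat split; try lra; [apply lip0_const |].
intros h _; ring.
Qed.

Lemma cderiv_id (z : C) : cderiv (fun w => w) z 1.
Proof.
exists (fun _ => 1), 1%R; repeat split; try lra; [apply lip0_const |].
intros h _; ring.
Qed.

Lemma cderiv_plus (f g : C -> C) (z l m : C) :
  cderiv f z l -> cderiv g z m -> cderiv (fun w => f w + g w) z (l + m).
Proof.
intros (phi & d & hphi & hl & hd & H) (psi & d' & hpsi & hm & hd' & H').
exists (fun h => phi h + psi h), (Rmin d d'); repeat split.
- now apply lip0_plus.
- now rewrite hl, hm.
- now apply Rmin_pos.
- intros h hh; rewrite H, H'; [ring | |];
  eapply Rlt_le_trans; try exact hh; [apply Rmin_r | apply Rmin_l].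
Qed.

Lemma cderiv_mult (f g : C -> C) (z l m : C) :
  cderiv f z l -> cderiv g z m ->
  cderiv (fun w => f w * g w) z (l * g z + f z * m).
Proof.
intros (phi & d & hphi & hl & hd & H) hg.
assert (hg' := cderiv_lip0 _ _ _ hg).
destruct hg as (psi & d' & hpsi & hm & hd' & H').
exists (fun h => phi h * g (z + h) + f z * psi h), (Rmin d d'); repeat split.
- apply lip0_plus; apply lip0_mult; auto using lip0_const.
- rewrite hl, hm; now replace (z + 0) with z by ring.
- now apply Rmin_pos.
- intros h hh; rewrite H, H'; [ring | |];
  eapply Rlt_le_trans; try exact hh; [apply Rmin_r | apply Rmin_l].
Qed.

Lemma cderiv_inv (f : C -> C) (z l : C) :
  cderiv f z l -> f z <> 0 -> cderiv (fun w => / f w) z (- l / (f z * f z)).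
Proof.
intros hf hz; assert (hf' := cderiv_lip0 _ _ _ hf).
destruct hf as (phi & d & hphi & hl & hd & H).
assert (e0 : f (z + 0) = f z) by (f_equal; ring).
destruct (lip0_away_from_zero _ hf') as (d' & hd' & H');
  [now rewrite e0 |]; rewrite e0 in H'.
exists (fun h => (- (1)) * phi h * (/ f z * / f (z + h))), (Rmin d d'); repeat split.
- apply lip0_mult; apply lip0_mult; auto using lip0_const.
  apply lip0_inv; auto; now rewrite e0.
- rewrite hl, e0; field; exact hz.
- now apply Rmin_pos.
- intros h hh.
  assert (h1 := H' h (Rlt_le_trans _ _ _ hh (Rmin_r _ _))).
  assert (p := proj1 (Cmod_gt_0 _) hz).
  assert (nz : f (z + h) <> 0) by (apply Cmod_gt_0; lra).
  assert (e := H h (Rlt_le_trans _ _ _ hh (Rmin_l _ _))).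
  assert (e' : h * phi h = f (z + h) - f z) by (rewrite e; ring).
  replace (/ f z + h * (- (1) * phi h * (/ f z * / f (z + h))))
    with (/ f z - (h * phi h) * (/ f z * / f (z + h))) by ring.
  rewrite e'; field; tauto.
Qed.

Lemma cderiv_eq (f : C -> C) (z l m : C) : cderiv f z l -> l = m -> cderiv f z m.
Proof. now intros h <-. Qed.

(** The slope is the difference quotient, completed by [l] at h = 0; dividing the quadratic
    remainder by h gives its Lipschitz bound. Power series enter through this criterion. *)
Lemma cderiv_of_quadratic_remainder (f : C -> C) (z l : C) (M d : R) :
  (0 < d)%R -> (0 <= M)%R ->
  (forall h, (Cmod h < d)%R ->
     (Cmod (f (z + h)%C - f z - h * l) <= M * Cmod h ^ 2)%R) ->
  cderiv f z l.
Proof.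
intros hd hM H.
exists (fun h => if Ceq_dec h 0 then l else (f (z + h) - f z) / h), d.
repeat split; auto.
- exists M, d; repeat split; auto.
  intros h hh.
  destruct (Ceq_dec 0 0) as [_ | n]; [| congruence].
  destruct (Ceq_dec h 0) as [-> | n].
  + replace (l - l) with (RtoC 0) by ring; rewrite Cmod_0; lra.
  + replace ((f (z + h) - f z) / h - l) with ((f (z + h) - f z - h * l) / h)
      by (field; exact n).
    rewrite Cmod_div by exact n.
    assert (p := proj1 (Cmod_gt_0 _) n).
    apply Rle_div_l; auto.
    specialize (H h hh); lra.
- destruct (Ceq_dec 0 0); congruence.
- intros h hh; destruct (Ceq_dec h 0) as [-> | n].
  + replace (z + 0) with z by ring; ring.
  + field; exact n.
Qed.

(** * Complex derivatives as limits, and derivatives along real lines *)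

Lemma cderiv_is_derive (f : C -> C) (z l : C) :
  cderiv f z l -> @is_derive C_AbsRing C_NormedModule f z l.
Proof.
intros (phi & d & (M & d' & hM & hd' & H') & hl & hd & H).
split; [apply is_linear_scal_l |].
intros x hx.
assert (e : z = x)
  by (apply (is_filter_lim_locally_unique (K := C_AbsRing)
               (V := AbsRing_NormedModule C_AbsRing) z x hx)).
subst x; intros eps.
pose (r := Rmin d (Rmin d' (eps / (M + 1)))).
assert (hr : (0 < r)%R).
{ repeat apply Rmin_pos; auto.
  apply Rdiv_lt_0_compat; [apply cond_pos | lra]. }
assert (main : forall y : C, (Cmod (y - z) < r)%R ->
  (Cmod (f y - f z - (y - z) * l) <= eps * Cmod (y - z))%R);
  [| exists (mkposreal r hr); exact main].
intros y hy.
assert (k1 := Rmin_l d (Rmin d' (eps / (M + 1)))); fold r in k1.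
assert (k2 := Rmin_r d (Rmin d' (eps / (M + 1)))); fold r in k2.
assert (k3 := Rmin_l d' (eps / (M + 1))).
assert (k4 := Rmin_r d' (eps / (M + 1))).
assert (h1 := H (y - z) ltac:(lra)); assert (h2 := H' (y - z) ltac:(lra)).
replace (z + (y - z)) with y in h1 by ring.
replace (f y - f z - (y - z) * l) with ((y - z) * (phi (y - z) - phi 0))
  by (rewrite h1, hl; ring).
rewrite Cmod_mult, Rmult_comm.
apply Rmult_le_compat_r; [apply Cmod_ge_0 |].
eapply Rle_trans; [exact h2 |].
assert (h3 : (Cmod (y - z) <= eps / (M + 1))%R) by lra.
apply Rle_div_r in h3; [| lra].
assert (q := Cmod_ge_0 (y - z)); lra.
Qed.

(** The chain rule along t -> z + t e, split into real and imaginary parts so that real calculus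
    applies to them. *)
Lemma cderiv_line (f : C -> C) (z e l : C) (t : R) :
  cderiv f (z + RtoC t * e) l ->
  is_derive (fun s : R => Re (f (z + RtoC s * e))) t (Re (e * l)%C) /\
  is_derive (fun s : R => Im (f (z + RtoC s * e))) t (Im (e * l)%C).
Proof.
intros (phi & d & (M & d' & hM & hd' & H') & hl & hd & H).
assert (key : forall eps : R, (0 < eps)%R -> exists r : posreal,
  forall s : R, (Rabs (s - t) < r)%R ->
   (Cmod (f (z + RtoC s * e)%C - f (z + RtoC t * e)%C - RtoC (s - t) * (e * l))
    <= eps * Rabs (s - t))%R).
{ intros eps he.
  assert (pe := Cmod_ge_0 e).
  (* A positive bound for |e|, valid also for e = 0. The remainder is then at most M (k |s - t|)^2,
     and the third entry of [r] makes this at most eps |s - t|. *)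
  pose (k := (Cmod e + 1)%R).
  pose (r := Rmin (d / k) (Rmin (d' / k) (eps / ((M + 1) * k * k)))).
  assert (hk : (0 < (M + 1) * k * k)%R) by (unfold k; apply Rmult_lt_0_compat; nra).
  assert (hr : (0 < r)%R).
  { repeat apply Rmin_pos; apply Rdiv_lt_0_compat; unfold k in *; lra. }
  exists (mkposreal r hr); simpl; intros s hs.
  assert (k1 := Rmin_l (d / k) (Rmin (d' / k) (eps / ((M + 1) * k * k)))).
  assert (k2 := Rmin_r (d / k) (Rmin (d' / k) (eps / ((M + 1) * k * k)))).
  fold r in k1, k2.
  assert (k3 := Rmin_l (d' / k) (eps / ((M + 1) * k * k))).
  assert (k4 := Rmin_r (d' / k) (eps / ((M + 1) * k * k))).
  assert (k0 : (0 < k)%R) by (unfold k; lra).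
  assert (j1 : (Rabs (s - t) < d / k)%R) by lra.
  assert (j2 : (Rabs (s - t) < d' / k)%R) by lra.
  assert (j3 : (Rabs (s - t) < eps / ((M + 1) * k * k))%R) by lra.
  apply Rlt_div_r in j1, j2, j3; auto.
  set (h := RtoC (s - t) * e).
  assert (mh : Cmod h = (Rabs (s - t) * Cmod e)%R)
    by (unfold h; now rewrite Cmod_mult, Cmod_R).
  assert (pa := Rabs_pos (s - t)).
  assert (mh' : (Cmod h <= Rabs (s - t) * k)%R)
    by (rewrite mh; unfold k; nra).
  replace (z + RtoC s * e) with (z + RtoC t * e + h)
    by (unfold h; rewrite RtoC_minus; ring).
  rewrite H by lra.
  replace (f (z + RtoC t * e) + h * phi h - f (z + RtoC t * e)
           - RtoC (s - t) * (e * l))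
    with (h * (phi h - phi 0)) by (rewrite hl; unfold h; ring).
  rewrite Cmod_mult.
  assert (q := H' h ltac:(lra)).
  assert (q0 := Cmod_ge_0 h); assert (q1 := Cmod_ge_0 (phi h - phi 0)).
  apply Rle_trans with ((Rabs (s - t) * k) * (M * (Rabs (s - t) * k)))%R.
  - apply Rmult_le_compat; auto; eapply Rle_trans; [exact q |].
    apply Rmult_le_compat_l; lra.
  - replace (Rabs (s - t) * k * (M * (Rabs (s - t) * k)))%R
      with (Rabs (s - t) * (Rabs (s - t) * (M * k * k)))%R by ring.
    rewrite (Rmult_comm eps); apply Rmult_le_compat_l; auto.
    apply Rle_trans with (Rabs (s - t) * ((M + 1) * k * k))%R; [| lra].
    apply Rmult_le_compat_l; nra. }
split; split; try apply is_linear_scal_l;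
  intros x hx;
  assert (ex : t = x)
    by (apply (is_filter_lim_locally_unique (K := R_AbsRing)
               (V := AbsRing_NormedModule R_AbsRing) t x hx));
  subst x; intros eps; destruct (key eps (cond_pos eps)) as (r & hr);
  exists r; intros s hs; specialize (hr s hs).
- change (Rabs (Re (f (z + RtoC s * e)%C) - Re (f (z + RtoC t * e)%C)
      - (s - t) * Re (e * l)%C) <= eps * Rabs (s - t))%R.
  eapply Rle_trans; [| exact hr].
  eapply Rle_trans; [| apply Rabs_Re_le].
  apply Req_le; f_equal; unfold Re, Im; simpl; ring.
- change (Rabs (Im (f (z + RtoC s * e)%C) - Im (f (z + RtoC t * e)%C)
      - (s - t) * Im (e * l)%C) <= eps * Rabs (s - t))%R.
  eapply Rle_trans; [| exact hr].
  eapply Rle_trans; [| apply Rabs_Im_le].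
  apply Req_le; f_equal; unfold Re, Im; simpl; ring.
Qed.

(** * Compactness *)

Lemma Cmod_lt_of_coords (x : C) (d : R) :
  (Rabs (Re x) < d)%R -> (Rabs (Im x) < d)%R -> (Cmod x < 2 * d)%R.
Proof.
intros h1 h2; assert (h := Cmod_2Rmax x).
assert (h3 : (Rmax (Rabs (fst x)) (Rabs (snd x)) < d)%R) by (now apply Rmax_lub_lt).
assert (h4 : (0 <= Rmax (Rabs (fst x)) (Rabs (snd x)))%R).
{ eapply Rle_trans; [apply Rabs_pos | apply Rmax_l]. }
assert (h5 : (sqrt 2 <= 2)%R).
{ rewrite <- (sqrt_Rsqr 2) at 2 by lra; apply sqrt_le_1_alt; unfold Rsqr; lra. }
nra.
Qed.

(** The maximizer has to satisfy [P] but not to lie in [l], so a list without points of [P] is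
    covered too. *)
Lemma finite_list_max (A : Type) (P : A -> Prop) (u : A -> R) (l : list A) :
  (exists x, P x) ->
  exists y, P y /\ forall x, In x l -> P x -> (u x <= u y)%R.
Proof.
intros (x0 & h0); induction l as [| x l (y & hy & IH)].
- exists x0; split; [auto | intros x []].
- destruct (classic (P x /\ (u y < u x)%R)) as [[hx hlt] | hn].
  + exists x; split; auto; intros w [<- | hw] hP; [lra |].
    specialize (IH w hw hP); lra.
  + exists y; split; auto; intros w [<- | hw] hP; [| auto].
    apply Rnot_lt_le; intro; now apply hn.
Qed.

(** An upper semicontinuous function on a closed bounded set attains its maximum. Otherwise every
    point of [K] has a neighbourhood on which [u] stays below its value at some other point of [K].
    Finitely many such neighbourhoods, together with some missing [K], cover [K], and the best of
    the finitely many values would have to exceed itself. *)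
Lemma compact_max (K : C -> Prop) (u : C -> R) (B : R) :
  (exists z, K z) ->
  (forall z, K z -> (Cmod z <= B)%R) ->
  (forall z, ~ K z ->
     exists d, (0 < d)%R /\ forall w, (Cmod (w - z) < d)%R -> ~ K w) ->
  (forall z, K z -> forall eps, (0 < eps)%R ->
     exists d, (0 < d)%R /\
       forall w, K w -> (Cmod (w - z) < d)%R -> (u w < u z + eps)%R) ->
  exists z, K z /\ forall w, K w -> (u w <= u z)%R.
Proof.
intros hne hB hcl hu; apply NNPP; intro hno.
assert (hbig : forall z, K z -> exists y, K y /\ (u z < u y)%R).
{ intros z hz; apply NNPP; intro h; apply hno; exists z; split; auto.
  intros w hw; apply Rnot_lt_le; intro; apply h; eauto. }
(* A radius and a better point for each z; outside [K] the second entry is a dummy. The factor 2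
   pays for passing from coordinatewise distance to the modulus. *)
assert (hloc : forall z : C, exists dy : posreal * C,
  (K z -> K (snd dy)) /\
  forall w, K w -> (Cmod (w - z) < 2 * fst dy)%R -> K z /\ (u w < u (snd dy))%R).
{ intro z; destruct (classic (K z)) as [hz | hz].
  - destruct (hbig z hz) as (y & hy & hlt).
    destruct (hu z hz (u y - u z)%R ltac:(lra)) as (d & hd & H).
    assert (hd2 : (0 < d / 2)%R) by lra.
    exists (mkposreal _ hd2, y); simpl; split; auto.
    intros w hw hwz; split; auto; specialize (H w hw ltac:(lra)); lra.
  - destruct (hcl z hz) as (d & hd & H).
    assert (hd2 : (0 < d / 2)%R) by lra.
    exists (mkposreal _ hd2, z); simpl; split; [tauto |].
    intros w hw hwz; exfalso; apply (H w); auto; lra. }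
destruct (choice _ hloc) as (D & HD).
pose (toC := fun t : Compactness.Tn 2 R => (fst t, fst (snd t)) : C).
(* A finite cover of the square [-B, B]^2 exists up to a double negation, which the goal [False]
   absorbs. *)
apply (compactness_list 2 (-B, (-B, tt))%R (B, (B, tt))%R (fun t => fst (D (toC t)))).
intros (l & hl).
destruct (finite_list_max _ K u (map (fun t => snd (D (toC t))) l) hne)
  as (y & hy & hmax).
assert (by' := hB y hy).
assert (b1 := Rabs_Re_le y); assert (b2 := Rabs_Im_le y).
destruct (hl (Re y, (Im y, tt))) as (t & ht & _ & hclose).
{ simpl; unfold Re, Im in *.
  assert (c1 : (Rabs (fst y) <= B)%R) by lra.
  assert (c2 : (Rabs (snd y) <= B)%R) by lra.
  apply Rabs_le_between in c1, c2; tauto. }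
destruct t as (t1 & t2 & []); simpl in hclose.
destruct hclose as (c1 & c2 & _).
destruct (HD (t1, t2)) as (q1 & q2).
destruct (q2 y hy) as (q3 & q4).
{ apply Cmod_lt_of_coords; assumption. }
specialize (hmax (snd (D (t1, t2)))).
assert (u (snd (D (t1, t2))) <= u y)%R; [| lra].
apply hmax; auto.
apply in_map_iff; exists (t1, (t2, tt)); auto.
Qed.

(** * Complex power series *)

(** The same [iota] as in [hyp2F1], so that [hyp2F1 a b c] is convertible to
    [psum (hyp2F1_coef a b c)]. *)
Definition psum (A : nat -> C) (z : C) : C :=
  @iota C_CompleteNormedModule
    (fun l => @is_pseries C_AbsRing C_NormedModule A z l).

(** Convergence on the whole unit disk, expressed by moduli because [CV_radius] is defined for real
    sequences. *)
Definition disk_coef (A : nat -> C) : Prop :=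
  Rbar_le 1 (CV_radius (fun n => Cmod (A n))).

Definition dcoef (A : nat -> C) (n : nat) : C := RtoC (INR (S n)) * A (S n).

Lemma disk_coef_dcoef (A : nat -> C) : disk_coef A -> disk_coef (dcoef A).
Proof.
unfold disk_coef; intro h; rewrite <- CV_radius_derive in h.
erewrite CV_radius_ext; [exact h |].
intro n; unfold PS_derive, dcoef; rewrite Cmod_mult, Cmod_R, Rabs_pos_eq; auto.
apply pos_INR.
Qed.

Lemma disk_coef_ex_series (A : nat -> C) (r : R) :
  disk_coef A -> (0 <= r < 1)%R -> ex_series (fun n => (Cmod (A n) * r ^ n)%R).
Proof.
intros hA [h0 h1].
apply (ex_series_ext (fun n => Rabs (Cmod (A n) * r ^ n))).
- intro n; apply Rabs_pos_eq, Rmult_le_pos; [apply Cmod_ge_0 | now apply pow_le].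
- apply CV_disk_inside.
  eapply Rbar_lt_le_trans; [| exact hA]; simpl; rewrite Rabs_pos_eq; lra.
Qed.

Lemma Cmod_pow_n (z : C) (n : nat) : Cmod (@pow_n C_Ring z n) = (Cmod z ^ n)%R.
Proof.
induction n as [| n IH]; simpl.
- apply Cmod_1.
- rewrite <- IH; apply Cmod_mult.
Qed.

Lemma disk_coef_ex_pseries (A : nat -> C) (z : C) :
  disk_coef A -> in_disk z ->
  exists l : C, @is_pseries C_AbsRing C_NormedModule A z l.
Proof.
intros hA hz.
apply (@ex_series_le C_AbsRing C_CompleteNormedModule _
         (fun n => (Cmod (A n) * Cmod z ^ n)%R)).
- intro n; change (Cmod (@pow_n C_Ring z n * A n) <= Cmod (A n) * Cmod z ^ n)%R.
  rewrite Cmod_mult, Cmod_pow_n; lra.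
- apply disk_coef_ex_series; auto; split; [apply Cmod_ge_0 | exact hz].
Qed.

Lemma is_pseries_psum (A : nat -> C) (z l : C) :
  @is_pseries C_AbsRing C_NormedModule A z l -> psum A z = l.
Proof.
intro h; apply (@iota_unique C_AbsRing C_CompleteNormedModule).
- intros y hy; exact (filterlim_locally_unique (K := C_AbsRing) (V := C_NormedModule) _ _ _ hy h).
- exact h.
Qed.

Lemma psum_correct (A : nat -> C) (z : C) :
  disk_coef A -> in_disk z -> @is_pseries C_AbsRing C_NormedModule A z (psum A z).
Proof.
intros hA hz; destruct (disk_coef_ex_pseries A z hA hz) as (l & hl).
now rewrite (is_pseries_psum A z l hl).
Qed.

Lemma psum_0 (A : nat -> C) : psum A 0 = A 0%nat.
Proof.
apply is_pseries_psum, (@is_pseries_0 C_AbsRing C_NormedModule).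
Qed.

Lemma Cmod_series_le (a : nat -> C) (b : nat -> R) (l : C) :
  @is_series C_AbsRing C_NormedModule a l -> ex_series b ->
  (forall n, (Cmod (a n) <= b n)%R) -> (Cmod l <= Series b)%R.
Proof.
intros ha hb hab.
assert (h1 : is_lim_seq (fun n => Cmod (sum_n (G := C_AbelianMonoid) a n)) (Cmod l)).
{ eapply filterlim_comp; [exact ha |].
  apply (@filterlim_norm C_AbsRing C_NormedModule l). }
assert (h2 : is_lim_seq (sum_n b) (Series b)) by (exact (Series_correct b hb)).
refine (is_lim_seq_le _ _ _ _ _ h1 h2).
intro n; induction n as [| n IH].
- rewrite !sum_O; apply hab.
- rewrite !sum_Sn.
  eapply Rle_trans; [apply Cmod_triangle |].
  apply Rplus_le_compat; auto.
Qed.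

(** Let D_n be the first-order Taylor remainder of the power n + 2. Then D_(n+1) = (z + h) D_n + (n
    + 2) h^2 z^(n+1), and the bound follows by induction. The factor (n + 1) (n + 2) is the one
    produced by applying [dcoef] twice. *)
Lemma pow_remainder_bound (z h : C) (r : R) (n : nat) :
  (Cmod z <= r)%R -> (Cmod (z + h) <= r)%R ->
  (Cmod (@pow_n C_Ring (z + h)%C (S (S n)) - @pow_n C_Ring z (S (S n))
         - h * (RtoC (INR (S (S n))) * @pow_n C_Ring z (S n)))
   <= INR (S n) * INR (S (S n)) * r ^ n * Cmod h ^ 2)%R.
Proof.
intros hz hzh.
assert (step : forall w k, @pow_n C_Ring w (S k) = w * @pow_n C_Ring w k)
  by reflexivity.
assert (hr : (0 <= r)%R) by (eapply Rle_trans; [apply Cmod_ge_0 | exact hz]).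
assert (ph := pow2_ge_0 (Cmod h)).
induction n as [| n IH].
- rewrite !step; simpl (@pow_n C_Ring _ 0).
  change (@one C_Ring) with (RtoC 1).
  replace (RtoC (INR 2)) with (RtoC 1 + RtoC 1) by (simpl; now rewrite RtoC_plus).
  match goal with |- (Cmod ?x <= _)%R => replace x with (h * h) by ring end.
  rewrite Cmod_mult; simpl in *; nra.
- set (D := @pow_n C_Ring (z + h)%C (S (S n)) - @pow_n C_Ring z (S (S n))
         - h * (RtoC (INR (S (S n))) * @pow_n C_Ring z (S n))) in *.
  replace (@pow_n C_Ring (z + h)%C (S (S (S n))) - @pow_n C_Ring z (S (S (S n)))
         - h * (RtoC (INR (S (S (S n)))) * @pow_n C_Ring z (S (S n))))
    with ((z + h) * D + RtoC (INR (S (S n))) * (h * h * @pow_n C_Ring z (S n))).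
  2:{ unfold D; rewrite (step _ (S (S n))), (step z (S (S n))), (step z (S n)).
      rewrite (S_INR (S (S n))), RtoC_plus; ring. }
  eapply Rle_trans; [apply Cmod_triangle |].
  rewrite !Cmod_mult, Cmod_R, Cmod_pow_n, (Rabs_pos_eq _ (pos_INR _)).
  assert (q0 := pos_INR (S n)); assert (q1 := pos_INR (S (S n))).
  assert (q2 : (Cmod z ^ S n <= r ^ S n)%R)
    by (apply pow_incr; split; [apply Cmod_ge_0 | exact hz]).
  assert (q3 : (0 <= r ^ n)%R) by (now apply pow_le).
  assert (q4 : (Cmod (z + h) * Cmod D <=
                r * (INR (S n) * INR (S (S n)) * r ^ n * Cmod h ^ 2))%R)
    by (apply Rmult_le_compat; auto; apply Cmod_ge_0).
  assert (q5 : (INR (S (S n)) * (Cmod h * Cmod h * Cmod z ^ S n)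
                <= INR (S (S n)) * (Cmod h * Cmod h * r ^ S n))%R).
  { apply Rmult_le_compat_l; auto.
    apply Rmult_le_compat_l; auto; nra. }
  assert (q6 : (0 <= INR (S (S n)) * (Cmod h ^ 2 * r ^ S n))%R).
  { apply Rmult_le_pos; auto; apply Rmult_le_pos; auto; now apply pow_le. }
  rewrite (S_INR (S (S n))).
  replace (INR (S n)) with (INR (S (S n)) - 1)%R in q4 by (rewrite (S_INR (S n)); ring).
  simpl (r ^ S n)%R in *; simpl (Cmod h ^ 2)%R in *; nra.
Qed.

(** Summing the remainder bounds of the powers gives a quadratic remainder whose constant is the
    majorant series of the second derivative at [r], a radius midway between |z| and 1. *)
Lemma psum_cderiv (A : nat -> C) (z : C) :
  disk_coef A -> in_disk z -> cderiv (psum A) z (psum (dcoef A) z).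
Proof.
intros hA hz; unfold in_disk in hz.
assert (hA1 := disk_coef_dcoef _ hA); assert (hA2 := disk_coef_dcoef _ hA1).
pose (r := ((1 + Cmod z) / 2)%R).
assert (p := Cmod_ge_0 z).
assert (hr : (0 <= r < 1)%R) by (unfold r; lra).
assert (hs := disk_coef_ex_series _ _ hA2 hr).
set (b := fun n => (Cmod (dcoef (dcoef A) n) * r ^ n)%R) in hs.
assert (hb : forall n, (0 <= b n)%R)
  by (intro n; apply Rmult_le_pos; [apply Cmod_ge_0 | apply pow_le; lra]).
apply cderiv_of_quadratic_remainder with (M := Series b) (d := ((1 - Cmod z) / 2)%R);
  [lra | |].
- assert (e : Series (fun n => 0 * b n)%R = 0%R) by (rewrite Series_scal_l; ring).
  rewrite <- e; apply Series_le; auto.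
  intro n; specialize (hb n); lra.
- intros h hh.
  assert (hzh : (Cmod (z + h) <= r)%R).
  { eapply Rle_trans; [apply Cmod_triangle | unfold r; lra]. }
  assert (s1 := psum_correct A (z + h) hA ltac:(unfold in_disk; lra)).
  assert (s2 := psum_correct A z hA hz).
  assert (s3 := psum_correct _ z hA1 hz).
  set (f1 := psum A (z + h)) in *; set (f2 := psum A z) in *.
  set (f3 := psum (dcoef A) z) in *.
  unfold is_pseries in s1, s2, s3.
  (* The series of remainders starts at the power 2, since those of the powers 0 and 1 vanish; hence
     the index shifts below. *)
  pose (T := fun n => @pow_n C_Ring (z + h) (S (S n)) * A (S (S n))
       - @pow_n C_Ring z (S (S n)) * A (S (S n))
       - h * (@pow_n C_Ring z (S n) * dcoef A (S n))).
  assert (hT : @is_series C_AbsRing C_NormedModule T (f1 - f2 - h * f3)).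
  { assert (t1 : forall w f : C, @is_series C_AbsRing C_NormedModule
        (fun n => @scal C_AbsRing C_NormedModule (@pow_n C_Ring w n) (A n)) f ->
        @is_series C_AbsRing C_NormedModule
        (fun n => @pow_n C_Ring w (S (S n)) * A (S (S n))) (f - A 0%nat - w * A 1%nat)).
    { intros w f H.
      apply (is_series_incr_1 (fun n => @pow_n C_Ring w (S n) * A (S n)) (f - A 0%nat - w * A 1%nat)).
      apply (is_series_incr_1 (fun n => @pow_n C_Ring w n * A n)).
      match goal with |- is_series _ ?l => replace l with f; [exact H |] end.
      change (@eq C f (f - A 0%nat - w * A 1%nat + w * 1 * A 1%nat + 1 * A 0%nat)); ring. }
    assert (t2 : @is_series C_AbsRing C_NormedModule
        (fun n => @pow_n C_Ring z (S n) * dcoef A (S n)) (f3 - A 1%nat)).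
    { apply (is_series_incr_1 (fun n => @pow_n C_Ring z n * dcoef A n)).
      match goal with |- is_series _ ?l => replace l with f3; [exact s3 |] end.
      change (@eq C f3 (f3 - A 1%nat + 1 * (1 * A 1%nat))); ring. }
    assert (t3 := is_series_minus _ _ _ _ (t1 _ _ s1) (t1 _ _ s2)).
    assert (t4 := @is_series_scal C_AbsRing C_NormedModule h _ _ t2).
    assert (t5 := is_series_minus _ _ _ _ t3 t4).
    match type of t5 with is_series _ ?l =>
      replace (f1 - f2 - h * f3) with l; [exact t5 |] end.
    change (@eq C (f1 - A 0%nat - (z + h) * A 1%nat - (f2 - A 0%nat - z * A 1%nat)
       - h * (f3 - A 1%nat)) (f1 - f2 - h * f3)); ring. }
  rewrite <- Series_scal_r.
  apply (Cmod_series_le T); auto.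
  + now apply ex_series_scal_r.
  + intro n; unfold T, b.
    assert (q := pow_remainder_bound z h r n ltac:(unfold r; lra) hzh).
    unfold dcoef.
    match goal with |- (Cmod ?x <= _)%R =>
      replace x with ((@pow_n C_Ring (z + h)%C (S (S n)) - @pow_n C_Ring z (S (S n))
         - h * (RtoC (INR (S (S n))) * @pow_n C_Ring z (S n))) * A (S (S n))) by ring end.
    rewrite !Cmod_mult, !Cmod_R, !(Rabs_pos_eq _ (pos_INR _)).
    eapply Rle_trans; [apply Rmult_le_compat_r; [apply Cmod_ge_0 | exact q] |].
    apply Req_le; ring.
Qed.

(** * Maximum principles *)

Lemma is_derive_eps (f : R -> R) (t l eps : R) :
  is_derive f t l -> (0 < eps)%R ->
  exists d, (0 < d)%R /\ forall s, (Rabs (s - t) < d)%R ->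
    (Rabs (f s - f t - (s - t) * l) <= eps * Rabs (s - t))%R.
Proof.
intros [_ H] he.
destruct (H t (fun P hP => hP) (mkposreal eps he)) as (d & hd).
exists d; split; [apply cond_pos |].
exact (fun s hs => hd s hs).
Qed.

(** If l > 0, then v' is positive just to the right of 0 when v' 0 >= 0, and negative just to the
    left when v' 0 < 0. By the mean value theorem v exceeds v 0 on that side. *)
Lemma second_derivative_at_max (v v' : R -> R) (l d : R) :
  (0 < d)%R ->
  (forall t, (Rabs t < d)%R -> is_derive v t (v' t)) ->
  is_derive v' 0 l ->
  (forall t, (Rabs t < d)%R -> (v t <= v 0)%R) -> (l <= 0)%R.
Proof.
intros hd hv hv' hmax; apply Rnot_lt_le; intro hl.
destruct (is_derive_eps v' 0 l (l / 2) hv' ltac:(lra)) as (d' & hd' & H).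
pose (r := (Rmin d d' / 2)%R).
assert (k1 := Rmin_l d d'); assert (k2 := Rmin_r d d').
assert (k3 := Rmin_pos d d' hd hd').
assert (hr : (0 < r)%R) by (unfold r; lra).
assert (hsmall : forall x, (- r <= x <= r)%R -> (Rabs x < d /\ Rabs x < d')%R).
{ intros x hx; split; apply Rabs_def1; unfold r in *; lra. }
assert (hH : forall x, (- r <= x <= r)%R ->
  (Rabs (v' x - v' 0 - x * l) <= l / 2 * Rabs x)%R).
{ intros x hx; specialize (H x); rewrite Rminus_0_r in H; now apply H, hsmall. }
destruct (Rle_dec 0 (v' 0)) as [h0 | h0].
- destruct (MVT_cor2 v v' 0 r hr) as (c & e & hc).
  { intros x hx; apply is_derive_Reals, hv, hsmall; split; lra. }
  assert (hm := hmax r ltac:(apply hsmall; split; lra)).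
  assert (hc' := hH c ltac:(lra)).
  rewrite (Rabs_pos_eq c) in hc' by lra; apply Rabs_le_between in hc'.
  assert (0 < c * l)%R by nra; assert (0 < v' c)%R by lra; nra.
- destruct (MVT_cor2 v v' (- r) 0 ltac:(lra)) as (c & e & hc).
  { intros x hx; apply is_derive_Reals, hv, hsmall; split; lra. }
  assert (hm := hmax (- r)%R ltac:(apply hsmall; split; lra)).
  assert (hc' := hH c ltac:(lra)).
  rewrite (Rabs_left c) in hc' by lra; apply Rabs_le_between in hc'.
  assert (c * l < 0)%R by nra; assert (v' c < 0)%R by lra; nra.
Qed.

Lemma is_derive_sumsq (f g : R -> R) (t l m : R) :
  is_derive f t l -> is_derive g t m ->
  is_derive (fun s => f s ^ 2 + g s ^ 2)%R t (2 * (f t * l + g t * m))%R.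
Proof.
intros hf hg.
assert (h := is_derive_plus _ _ _ _ _
  (is_derive_mult f f t l l hf hf Rmult_comm)
  (is_derive_mult g g t m m hg hg Rmult_comm)).
unfold plus, mult in h; simpl in h.
match type of h with is_derive _ _ ?x =>
  replace (2 * (f t * l + g t * m))%R with x by ring end.
eapply is_derive_ext; [| exact h]; intro s; simpl; ring.
Qed.

Lemma is_derive_Cmod2_line (f : C -> C) (z e l : C) (t : R) :
  cderiv f (z + RtoC t * e)%C l ->
  is_derive (fun s : R => (Cmod (f (z + RtoC s * e)%C) ^ 2)%R) t
    (2 * Re (Cconj (f (z + RtoC t * e)%C) * (e * l))%C)%R.
Proof.
intro h; destruct (cderiv_line f z e l t h) as (h1 & h2).
assert (h3 := is_derive_sumsq _ _ _ _ _ h1 h2).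
match type of h3 with is_derive _ _ ?x =>
  replace (2 * Re (Cconj (f (z + RtoC t * e)%C) * (e * l))%C)%R with x end.
- eapply is_derive_ext; [| exact h3]; intro s; now rewrite Cmod2_alt.
- unfold Re, Im, Cconj; simpl; ring.
Qed.

(** The left side of the conclusion is half the second derivative at t = 0 of |g|^2 + eps |.|^2
    restricted to the line z + t e. *)
Lemma second_derivative_line_at_max (g g1 : C -> C) (g2 z e : C) (eps d : R) :
  (0 < d)%R ->
  (forall t, (Rabs t < d)%R ->
     cderiv g (z + RtoC t * e)%C (g1 (z + RtoC t * e)%C)) ->
  cderiv g1 z g2 ->
  (forall t, (Rabs t < d)%R ->
     (Cmod (g (z + RtoC t * e)%C) ^ 2 + eps * Cmod (z + RtoC t * e) ^ 2
      <= Cmod (g z) ^ 2 + eps * Cmod z ^ 2)%R) ->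
  (Cmod (e * g1 z) ^ 2 + Re (Cconj (g z) * (e * (e * g2)))%C
     + eps * Cmod e ^ 2 <= 0)%R.
Proof.
intros hd hg hg1 hmax.
assert (z0 : z + RtoC 0 * e = z) by ring.
pose (v' := fun t : R =>
  (2 * (Re (g (z + RtoC t * e)%C) * Re (e * g1 (z + RtoC t * e)%C)%C
        + Im (g (z + RtoC t * e)%C) * Im (e * g1 (z + RtoC t * e)%C)%C)
   + eps * (2 * Re (Cconj (z + RtoC t * e) * (e * 1))%C))%R).
assert (H : (2 * (Cmod (e * g1 z) ^ 2 + Re (Cconj (g z) * (e * (e * g2)))%C
     + eps * Cmod e ^ 2) <= 0)%R); [| lra].
apply (second_derivative_at_max
  (fun t => Cmod (g (z + RtoC t * e)%C) ^ 2 + eps * Cmod (z + RtoC t * e) ^ 2)%R v' _ d hd).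
- intros t ht.
  assert (h1 := is_derive_Cmod2_line g z e _ t (hg t ht)).
  assert (h2 := is_derive_Cmod2_line (fun w => w) z e 1 t (cderiv_id _)).
  assert (h3 := is_derive_plus _ _ _ _ _ h1 (is_derive_scal _ _ eps _ h2)).
  unfold plus, scal in h3; simpl in h3.
  unfold v'; match type of h3 with is_derive _ _ ?x => match goal with
    |- is_derive _ _ ?y => replace y with x; [exact h3 |] end end.
  unfold mult, Re, Im, Cconj; simpl; ring.
- destruct (cderiv_line g z e (g1 z) 0) as (a1 & a2).
  { specialize (hg 0%R); rewrite Rabs_R0, z0 in hg; rewrite z0; auto. }
  assert (hg1' : cderiv (fun w => e * g1 w) (z + RtoC 0 * e) (e * g2)).
  { rewrite z0; eapply cderiv_eq;
    [apply cderiv_mult; [apply cderiv_const | exact hg1] | cbv beta; ring]. }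
  destruct (cderiv_line _ z e _ 0 hg1') as (a3 & a4).
  assert (b1 := is_derive_mult _ _ _ _ _ a1 a3 Rmult_comm).
  assert (b2 := is_derive_mult _ _ _ _ _ a2 a4 Rmult_comm).
  assert (b3 : is_derive (fun t : R => 2 * Re (Cconj (z + RtoC t * e) * (e * 1))%C)%R
     0 (2 * (Re e ^ 2 + Im e ^ 2))%R).
  { unfold Re, Im, Cconj; simpl; auto_derive; auto; ring. }
  assert (b := is_derive_plus _ _ _ _ _
    (is_derive_scal _ _ 2%R _ (is_derive_plus _ _ _ _ _ b1 b2))
    (is_derive_scal _ _ eps _ b3)).
  cbv beta in b; rewrite !z0 in b; unfold plus, scal in b; simpl in b; unfold mult in b; simpl in b.
  unfold v'; match type of b with is_derive _ _ ?x => match goal with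
    |- is_derive _ _ ?y => replace y with x; [exact b |] end end.
  rewrite !Cmod2_alt; unfold Re, Im, Cconj; simpl; ring.
- intros t ht; rewrite z0; auto.
Qed.

Lemma Cmod_ball_of_lt (z : C) (r : R) :
  (Cmod z < r)%R -> forall w, (Cmod (w - z) < r - Cmod z)%R -> (Cmod w < r)%R.
Proof.
intros hz w hw; replace w with (z + (w - z)) by ring.
eapply Rle_lt_trans; [apply Cmod_triangle | lra].
Qed.

Lemma Cmod2_usc (f : C -> C) (z l : C) (k eps : R) :
  cderiv f z l -> (0 <= k)%R -> (0 < eps)%R ->
  exists d, (0 < d)%R /\ forall w, (Cmod (w - z) < d)%R ->
    (k * Cmod (f w) ^ 2 < k * Cmod (f z) ^ 2 + eps)%R.
Proof.
intros hf hk he.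
set (m := Cmod (f z)); assert (hm : (0 <= m)%R) by apply Cmod_ge_0.
(* For x <= 1 one has (m + x)^2 <= m^2 + x (2 m + 1), and this choice keeps k times the increment
   below eps. *)
pose (x := Rmin 1 (eps / ((k + 1) * (2 * m + 1)))).
assert (hK : (0 < (k + 1) * (2 * m + 1))%R) by nra.
assert (hx : (0 < x)%R)
  by (apply Rmin_pos; [lra | apply Rdiv_lt_0_compat; lra]).
assert (x1 : (x <= 1)%R) by apply Rmin_l.
assert (x2 : (x * ((k + 1) * (2 * m + 1)) <= eps)%R)
  by (apply Rle_div_r; [lra | apply Rmin_r]).
destruct (cderiv_continuous f z l x hf hx) as (d & hd & H).
exists d; split; auto; intros w hw; specialize (H w hw).
assert (h1 : (Cmod (f w) <= m + x)%R).
{ replace (f w) with (f z + (f w - f z)) by ring.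
  eapply Rle_trans; [apply Cmod_triangle | unfold m; lra]. }
assert (p := Cmod_ge_0 (f w)).
assert (h2 : (Cmod (f w) ^ 2 <= m ^ 2 + x * (2 * m + 1))%R) by nra.
assert (h3 : (0 < x * (2 * m + 1))%R) by nra.
nra.
Qed.

(* [|g|^2 + eps |z|^2] is strictly subharmonic, hence has no interior maximum. *)
Lemma maximum_modulus (g g1 : C -> C) (r m : R) :
  (0 < r)%R -> (0 <= m)%R ->
  (forall z, (Cmod z <= r)%R -> cderiv g z (g1 z) /\ exists g2, cderiv g1 z g2) ->
  (forall z, Cmod z = r -> (Cmod (g z) <= m)%R) ->
  forall z, (Cmod z <= r)%R -> (Cmod (g z) <= m)%R.
Proof.
intros hr hm hg hbd z hz.
assert (main : forall eps, (0 < eps)%R -> (Cmod (g z) ^ 2 <= m ^ 2 + eps * r ^ 2)%R).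
{ intros eps he.
  destruct (compact_max (fun w => (Cmod w <= r)%R)
    (fun w => Cmod (g w) ^ 2 + eps * Cmod w ^ 2)%R r) as (z1 & hz1 & hmax).
  - exists z; exact hz.
  - auto.
  - intros w hw; exists (Cmod w - r)%R; split; [lra |].
    intros w' hw' hle.
    assert (h := Cmod_triangle w' (- (w' - w))).
    replace (w' + - (w' - w)) with w in h by ring; rewrite Cmod_opp in h; lra.
  - intros w hw e' he'.
    destruct (hg w hw) as (hgw & _).
    destruct (Cmod2_usc g w _ 1 (e' / 2) hgw ltac:(lra) ltac:(lra)) as (d & hd & H).
    destruct (Cmod2_usc (fun w => w) w 1 eps (e' / 2) (cderiv_id w) ltac:(lra)
      ltac:(lra)) as (d' & hd' & H').
    exists (Rmin d d'); split; [now apply Rmin_pos |].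
    intros w' _ hw'.
    specialize (H w' (Rlt_le_trans _ _ _ hw' (Rmin_l _ _))).
    specialize (H' w' (Rlt_le_trans _ _ _ hw' (Rmin_r _ _))); simpl in *; lra.
  - assert (hb : Cmod z1 = r).
    { destruct (Rle_lt_or_eq_dec _ _ hz1) as [hlt | heq]; auto; exfalso.
      destruct (hg z1 hz1) as (_ & g2 & hg2).
      assert (hin : forall e, Cmod e = 1%R -> forall t,
        (Rabs t < r - Cmod z1)%R -> (Cmod (z1 + RtoC t * e) <= r)%R).
      { intros e h1 t ht; left; apply (Cmod_ball_of_lt z1 r hlt).
        replace (z1 + RtoC t * e - z1) with (RtoC t * e) by ring.
        rewrite Cmod_mult, Cmod_R, h1; lra. }
      assert (hsec : forall e, Cmod e = 1%R ->
        (Cmod (e * g1 z1) ^ 2 + Re (Cconj (g z1) * (e * (e * g2)))%C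
          + eps * Cmod e ^ 2 <= 0)%R).
      { intros e h1.
        apply (second_derivative_line_at_max g g1 g2 z1 e eps (r - Cmod z1));
          [lra | | exact hg2 |].
        - intros t ht; apply hg, hin; auto.
        - intros t ht; apply hmax, hin; auto. }
      (* Adding the inequalities for the directions 1 and i cancels the terms in [g2], as i^2 = -1,
         and leaves 2 |g1|^2 + 2 eps <= 0. *)
      assert (s1 := hsec 1 Cmod_1).
      assert (hi : Cmod Ci = 1%R).
      { unfold Cmod, Ci; simpl.
        replace (0 * (0 * 1) + 1 * (1 * 1))%R with 1%R by ring; apply sqrt_1. }
      assert (s2 := hsec Ci hi).
      rewrite Cmod_1 in s1; rewrite hi in s2.
      assert (q1 := pow2_ge_0 (Cmod (1 * g1 z1))).
      assert (q2 := pow2_ge_0 (Cmod (Ci * g1 z1))).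
      assert (q3 : (Re (Cconj (g z1) * (1 * (1 * g2)))%C
                + Re (Cconj (g z1) * (Ci * (Ci * g2)))%C = 0)%R)
        by (unfold Re, Cconj, Ci; simpl; ring).
      lra. }
    specialize (hmax z hz); specialize (hbd z1 hb); rewrite hb in hmax.
    assert (q := Cmod_ge_0 (g z1)).
    assert (q2 := Rmult_le_pos _ _ (Rlt_le _ _ he) (pow2_ge_0 (Cmod z))); nra. }
apply Rnot_lt_le; intro hlt.
assert (hk : (0 < Cmod (g z) ^ 2 - m ^ 2)%R) by nra.
(* This eps makes eps r^2 half of the supposed excess. *)
specialize (main ((Cmod (g z) ^ 2 - m ^ 2) / (2 * r ^ 2))%R).
assert (hr2 : (0 < r ^ 2)%R) by nra.
assert (h := main ltac:(apply Rdiv_lt_0_compat; lra)).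
replace ((Cmod (g z) ^ 2 - m ^ 2) / (2 * r ^ 2) * r ^ 2)%R
  with ((Cmod (g z) ^ 2 - m ^ 2) / 2)%R in h by (field; nra).
lra.
Qed.

(* At a boundary maximum of [|g|^2] the derivative in every inward direction is
   nonpositive; the directions [z0 (- eps +- i)] give both claims. *)
Lemma boundary_maximum_modulus (g : C -> C) (z0 g1 : C) :
  z0 <> 0 -> cderiv g z0 g1 ->
  (forall z, (Cmod z < Cmod z0)%R -> (Cmod (g z) <= Cmod (g z0))%R) ->
  (0 <= Re (Cconj (g z0) * (z0 * g1))%C)%R /\ Im (Cconj (g z0) * (z0 * g1)) = 0%R.
Proof.
intros hz hg hmax.
assert (p := proj1 (Cmod_gt_0 _) hz).
set (k := Cconj (g z0) * (z0 * g1)).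
assert (key : forall eps x : R, (0 < eps)%R ->
  (- eps * Re k - x * Im k <= 0)%R).
{ intros eps x he.
  apply Rnot_lt_le; intro hlt.
  set (e := z0 * (- eps, x)%R).
  assert (h := is_derive_Cmod2_line g z0 e g1 0).
  assert (ez : z0 + RtoC 0 * e = z0) by ring.
  rewrite ez in h; specialize (h hg).
  set (D := (- eps * Re k - x * Im k)%R) in *.
  assert (eD : (2 * Re (Cconj (g z0) * (e * g1))%C = 2 * D)%R)
    by (unfold D, k, e, Re, Im, Cconj; simpl; ring).
  rewrite eD in h.
  destruct (is_derive_eps _ _ _ D h hlt) as (d & hd & H).
  (* The first bound keeps t within the range of the derivative estimate; the second gives t (eps^2
     + x^2) <= eps, so that z0 + t e lies inside the circle. *)
  pose (t := Rmin (d / 2) (eps / (eps ^ 2 + x ^ 2))).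
  assert (hS : (0 < eps ^ 2 + x ^ 2)%R) by nra.
  assert (ht : (0 < t)%R)
    by (apply Rmin_pos; [lra | now apply Rdiv_lt_0_compat]).
  assert (t1 : (t <= d / 2)%R) by apply Rmin_l.
  assert (t2 : (t * (eps ^ 2 + x ^ 2) <= eps)%R)
    by (apply Rle_div_r; [lra | apply Rmin_r]).
  specialize (H t); rewrite Rminus_0_r, Rabs_pos_eq, ez in H by lra.
  specialize (H ltac:(lra)); apply Rabs_le_between in H.
  assert (hin : (Cmod (z0 + RtoC t * e) < Cmod z0)%R).
  { apply Rsqr_incrst_0; try apply Cmod_ge_0.
    rewrite !Rsqr_pow2.
    assert (E : (Cmod (z0 + RtoC t * e)%C ^ 2 = Cmod z0 ^ 2 *
       (1 - 2 * t * eps + t * (t * (eps ^ 2 + x ^ 2))))%R).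
    { rewrite !Cmod2_alt; unfold e, Re, Im; simpl; ring. }
    rewrite E.
    assert (0 < Cmod z0 ^ 2)%R by nra.
    assert (t * (t * (eps ^ 2 + x ^ 2)) <= t * eps)%R
      by (apply Rmult_le_compat_l; lra).
    assert (0 < t * eps)%R by nra.
    nra. }
  specialize (hmax _ hin).
  assert (q := Cmod_ge_0 (g (z0 + RtoC t * e)%C)).
  assert (0 < t * D)%R by nra.
  assert (Cmod (g (z0 + RtoC t * e)%C) ^ 2 <= Cmod (g z0) ^ 2)%R by (apply pow_incr; lra).
  lra. }
assert (hIm : Im k = 0%R).
{ apply NNPP; intro hn.
  (* With this x the inequality reads 1 <= 0. *)
  assert (K := key 1%R ((- (Re k) - 1) / Im k)%R ltac:(lra)).
  replace ((- Re k - 1) / Im k * Im k)%R with (- Re k - 1)%R in K by (field; exact hn).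
  lra. }
split; auto.
assert (K := key 1%R 0%R ltac:(lra)); lra.
Qed.

(** * The first boundary point *)

(** The points (1 - t) z lie inside the circle through z and tend to z as t decreases to 0. *)
Lemma nonneg_of_radial_limit (G : C -> R) (z : C) :
  (forall eps, (0 < eps)%R -> exists d, (0 < d)%R /\
     forall w, (Cmod (w - z) < d)%R -> (Rabs (G w - G z) < eps)%R) ->
  z <> 0 -> (forall w, (Cmod w < Cmod z)%R -> (0 < G w)%R) -> (0 <= G z)%R.
Proof.
intros hG hz hpos; apply Rnot_lt_le; intro hlt.
assert (p := proj1 (Cmod_gt_0 _) hz).
destruct (hG (- G z)%R ltac:(lra)) as (d & hd & H).
pose (t := Rmin (1 / 2) (d / (2 * Cmod z))).
assert (ht : (0 < t)%R)
  by (apply Rmin_pos; [lra | apply Rdiv_lt_0_compat; lra]).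
assert (t1 : (t <= 1 / 2)%R) by apply Rmin_l.
assert (t2 : (t * (2 * Cmod z) <= d)%R)
  by (apply Rle_div_r; [lra | apply Rmin_r]).
assert (a1 := H (z - RtoC t * z)).
assert (a2 := hpos (z - RtoC t * z)).
replace (z - RtoC t * z - z) with (- (RtoC t * z)) in a1 by ring.
replace (z - RtoC t * z) with (RtoC (1 - t) * z) in *
  by (rewrite RtoC_minus; ring).
rewrite Cmod_opp, Cmod_mult, Cmod_R, Rabs_pos_eq in a1 by lra.
rewrite Cmod_mult, Cmod_R, Rabs_pos_eq in a2 by lra.
specialize (a1 ltac:(nra)); specialize (a2 ltac:(nra)).
apply Rabs_def2 in a1; lra.
Qed.

(** The point minimizes |z| over the compact set of points with |z| <= |z1| and G z <= 0. All
    smaller moduli give G > 0, and radial limits then give G >= 0 on the whole circle, hence G = 0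
    at the point itself. *)
Lemma first_nonpositive_point (G : C -> R) :
  (forall z, in_disk z -> forall eps, (0 < eps)%R -> exists d, (0 < d)%R /\
     forall w, (Cmod (w - z) < d)%R -> (Rabs (G w - G z) < eps)%R) ->
  (0 < G 0)%R ->
  (exists z, in_disk z /\ (G z <= 0)%R) ->
  exists z0, in_disk z0 /\ z0 <> 0 /\ G z0 = 0%R /\
    (forall z, (Cmod z < Cmod z0)%R -> (0 < G z)%R) /\
    (forall z, Cmod z = Cmod z0 -> (0 <= G z)%R).
Proof.
intros hG hG0 (z1 & hz1 & hle).
unfold in_disk in *.
destruct (compact_max (fun z => (Cmod z <= Cmod z1)%R /\ (G z <= 0)%R)
            (fun z => - Cmod z)%R (Cmod z1)) as (z0 & (hz0 & hGz0) & hmin).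
- exists z1; split; [lra | auto].
- tauto.
- intros z hz.
  destruct (Rle_dec (Cmod z) (Cmod z1)) as [h1 | h1].
  + assert (h2 : (0 < G z)%R) by (apply Rnot_le_lt; tauto).
    destruct (hG z ltac:(lra) _ h2) as (d & hd & H).
    exists d; split; auto; intros w hw (_ & h).
    specialize (H w hw); apply Rabs_def2 in H; lra.
  + exists (Cmod z - Cmod z1)%R; split; [lra |].
    intros w hw (h & _).
    assert (h2 := Cmod_triangle w (- (w - z))).
    replace (w + - (w - z)) with z in h2 by ring; rewrite Cmod_opp in h2; lra.
- intros z _ eps he; exists eps; split; auto; intros w _ hw.
  assert (h2 := Cmod_triangle w (- (w - z))).
  replace (w + - (w - z)) with z in h2 by ring; rewrite Cmod_opp in h2; lra.
- assert (hne : z0 <> 0) by (intros ->; lra).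
  assert (hin : forall z, (Cmod z < Cmod z0)%R -> (0 < G z)%R).
  { intros z hz; apply Rnot_le_lt; intro h.
    assert (hz' : (Cmod z <= Cmod z1)%R) by lra.
    specialize (hmin z (conj hz' h)); lra. }
  assert (hbd : forall z, Cmod z = Cmod z0 -> (0 <= G z)%R).
  { intros z hz; apply nonneg_of_radial_limit.
    - apply hG; lra.
    - apply Cmod_gt_0; rewrite hz; now apply Cmod_gt_0.
    - now rewrite hz. }
  exists z0; repeat split; auto; [lra |].
  specialize (hbd z0 eq_refl); lra.
Qed.

(** * Positivity from the hypergeometric equation *)

Lemma quadratic_nonneg (L M N s : R) :
  (0 <= L)%R -> (0 <= N)%R -> (0 <= L * N - M ^ 2)%R ->
  (0 <= L * s ^ 2 + 2 * M * s + N)%R.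
Proof.
(* If L = 0 then M = 0; otherwise L times the quadratic is (L s + M)^2 + (L N - M^2). *)
intros hL hN hD; destruct (Req_dec L 0) as [-> | hL0].
- assert (M = 0)%R as -> by nra; lra.
- assert (0 <= L * (L * s ^ 2 + 2 * M * s + N))%R.
  { replace (L * (L * s ^ 2 + 2 * M * s + N))%R
      with ((L * s + M) ^ 2 + (L * N - M ^ 2))%R by ring.
    assert (q := pow2_ge_0 (L * s + M)); lra. }
  apply Rmult_le_reg_l with L; lra.
Qed.

(* In terms of [q = 1 + w = i s] and [X = - (1 + zeta) (1 + s^2) / 2 - s^2], the two
   sides of the equation are [X + (c-3) q + 2 - c] and
   [z (X + (a+b-2) q + (1-a)(1-b))]. *)
Lemma no_boundary_solution (a b c z v : C) (p s zeta : R) :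
  a + b + 1 - c = RtoC p ->
  (p < Re (a * b)%C)%R ->
  (0 <= condL a b c p)%R -> (0 <= condN a b c p)%R ->
  (0 <= condL a b c p * condN a b c p - condM a b ^ 2)%R ->
  in_disk z -> (0 <= zeta)%R ->
  let w := (-1, s)%R : C in
  2 * v = 3 * (w * w) - RtoC (zeta * (1 + s ^ 2)) ->
  v + c * w = z * (v + (a + b + 1) * w + a * b) -> False.
Proof.
intros hp hab hL hN hD hz hzeta w hv heq.
set (l := v + c * w) in heq; set (r := v + (a + b + 1) * w + a * b) in heq.
destruct a as (a1, a2), b as (b1, b2), c as (c1, c2), v as (v1, v2).
injection hp as e1 e2.
assert (c1 = a1 + b1 + 1 - p)%R as -> by lra.
assert (c2 = a2 + b2)%R as -> by lra.
assert (f1 := f_equal Re hv); assert (f2 := f_equal Im hv).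
unfold w, Re, Im in f1, f2; simpl in f1, f2.
assert (hq : (0 <= (Cmod l ^ 2 - Cmod r ^ 2))%R).
{ assert (E : (Cmod l ^ 2 - Cmod r ^ 2 =
      zeta * (1 + s ^ 2) * (Re ((a1, a2) * (b1, b2))%C - p)
      + (condL (a1, a2) (b1, b2) (a1 + b1 + 1 - p, a2 + b2)%R p * s ^ 2
         + 2 * (- condM (a1, a2) (b1, b2)) * s
         + condN (a1, a2) (b1, b2) (a1 + b1 + 1 - p, a2 + b2)%R p))%R).
  { unfold condL, condM, condN; rewrite !Cmod2_alt.
    replace (Cmod ((a1, a2) - 1) ^ 2 * Cmod ((b1, b2) - 1) ^ 2)%R
      with (((a1 - 1) ^ 2 + a2 ^ 2) * ((b1 - 1) ^ 2 + b2 ^ 2))%R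
      by (rewrite !Cmod2_alt; unfold Re, Im; simpl; ring).
    assert (v1 = (3 * (1 - s ^ 2) - zeta * (1 + s ^ 2)) / 2)%R as -> by lra.
    assert (v2 = - 3 * s)%R as -> by lra.
    unfold l, r, w, Re, Im, Cconj; simpl; field. }
  rewrite E; apply Rplus_le_le_0_compat.
  - apply Rmult_le_pos; [apply Rmult_le_pos; nra | lra].
  - apply quadratic_nonneg; auto; lra. }
assert (hlr : Cmod l = (Cmod z * Cmod r)%R) by (rewrite heq; apply Cmod_mult).
unfold in_disk in hz.
assert (pz := Cmod_ge_0 z); assert (pr := Cmod_ge_0 r).
assert (hr0 : Cmod r = 0%R).
{ rewrite hlr in hq; apply NNPP; intro hn.
  assert (0 < Cmod r ^ 2)%R by nra; assert (Cmod z ^ 2 < 1)%R by nra.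
  rewrite Rpow_mult_distr in hq; nra. }
assert (r0 := Cmod_eq_0 _ hr0).
assert (l0 : l = 0) by (apply Cmod_eq_0; rewrite hlr, hr0; ring).
assert (h := f_equal Re (eq_trans l0 (eq_sym r0))).
unfold l, r, w, Re in h, hab; simpl in h, hab; lra.
Qed.

(* [|zF|^2] increases along rays as long as [Re (conj F (zF)')] is positive. *)
Lemma no_zero_on_first_circle (F F1 : C -> C) (r : R) :
  (forall z, (Cmod z <= r)%R -> cderiv F z (F1 z)) -> F 0 <> 0 ->
  (forall z, (Cmod z < r)%R -> (0 < Re (Cconj (F z) * (F z + z * F1 z))%C)%R) ->
  forall z, (Cmod z <= r)%R -> F z <> 0.
Proof.
intros hF hF0 hpos z hz.
destruct (Ceq_dec z 0) as [-> | hn]; [exact hF0 |].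
assert (p := proj1 (Cmod_gt_0 _) hn).
assert (hd : forall t, (1 / 2 <= t <= 1)%R ->
  is_derive (fun s => Cmod ((0 + RtoC s * z) * F (0 + RtoC s * z)%C) ^ 2)%R t
   (2 * t * Cmod z ^ 2 *
    Re (Cconj (F (RtoC t * z)%C) * (F (RtoC t * z)%C + RtoC t * z * F1 (RtoC t * z)%C))%C)%R).
{ intros t ht.
  assert (e0 : 0 + RtoC t * z = RtoC t * z) by ring.
  assert (hin : (Cmod (0 + RtoC t * z) <= r)%R).
  { rewrite e0, Cmod_mult, Cmod_R, Rabs_pos_eq by lra; nra. }
  assert (h := is_derive_Cmod2_line (fun w => w * F w) 0 z _ t
    (cderiv_mult _ _ _ _ _ (cderiv_id _) (hF _ hin))).
  cbv beta in h; rewrite e0 in h.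
  match type of h with is_derive _ _ ?x => match goal with
    |- is_derive _ _ ?y => replace y with x; [exact h |] end end.
  rewrite Cmod2_alt; set (u := F _); set (u1 := F1 _).
  unfold Re, Im, Cconj; simpl; ring. }
(* If F z = 0, then |s z F (s z)|^2 vanishes at s = 1 and is nonnegative at s = 1/2, although its
   derivative is positive in between. *)
destruct (MVT_cor2 _ _ (1 / 2)%R 1%R ltac:(lra) 
  (fun t ht => proj1 (is_derive_Reals _ _ _) (hd t ht))) as (t & e & ht).
assert (hG := hpos (RtoC t * z)).
rewrite Cmod_mult, Cmod_R, Rabs_pos_eq in hG by lra.
specialize (hG ltac:(nra)).
intros hz0.
replace (0 + RtoC 1 * z) with z in e by ring.
rewrite hz0 in e; replace (z * 0) with (RtoC 0) in e by ring.
rewrite Cmod_0 in e.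
set (x := Cmod (_ * _)) in e; assert (q := pow2_ge_0 x).
assert (0 < Cmod z ^ 2)%R by nra.
assert (0 < t * Cmod z ^ 2)%R by (apply Rmult_lt_0_compat; lra).
set (G := Re _) in *.
assert (0 < t * Cmod z ^ 2 * G)%R by (apply Rmult_lt_0_compat; lra).
lra.
Qed.

(** With x = F and y = z F' this reads |2 F + z F'|^2 = |z F'|^2 + 4 G, which turns the sign of G
    into a comparison of |z g| with 1. *)
Lemma Cmod2_add_twice (x y : C) :
  (Cmod (2 * x + y) ^ 2 = Cmod y ^ 2 + 4 * Re (Cconj x * (x + y))%C)%R.
Proof. rewrite !Cmod2_alt; unfold Re, Im, Cconj; simpl; ring. Qed.

Lemma Re_conj_mul_continuous (f k : C -> C) (z l m : C) (eps : R) :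
  cderiv f z l -> cderiv k z m -> (0 < eps)%R ->
  exists d, (0 < d)%R /\ forall w, (Cmod (w - z) < d)%R ->
    (Rabs (Re (Cconj (f w) * k w)%C - Re (Cconj (f z) * k z)%C) < eps)%R.
Proof.
intros hf hk he.
assert (pf := Cmod_ge_0 (f z)); assert (pk := Cmod_ge_0 (k z)).
set (S := (Cmod (f z) + 1 + Cmod (k z))%R).
pose (x := Rmin 1 (eps / S)).
assert (hS : (0 < S)%R) by (unfold S; lra).
assert (hx : (0 < x)%R) by (apply Rmin_pos; [lra | now apply Rdiv_lt_0_compat]).
assert (x1 : (x <= 1)%R) by apply Rmin_l.
assert (x2 : (x * S <= eps)%R) by (apply Rle_div_r; [lra | apply Rmin_r]).
destruct (cderiv_continuous f z l x hf hx) as (d & hd & H).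
destruct (cderiv_continuous k z m x hk hx) as (d' & hd' & H').
exists (Rmin d d'); split; [now apply Rmin_pos |]; intros w hw.
specialize (H w (Rlt_le_trans _ _ _ hw (Rmin_l _ _))).
specialize (H' w (Rlt_le_trans _ _ _ hw (Rmin_r _ _))).
assert (h1 : (Cmod (f w) <= Cmod (f z) + x)%R).
{ replace (f w) with (f z + (f w - f z)) by ring.
  eapply Rle_trans; [apply Cmod_triangle | lra]. }
eapply Rle_lt_trans with
  (Cmod (Cconj (f w) * (k w - k z) + Cconj (f w - f z) * k z)).
- eapply Rle_trans; [| apply Rabs_Re_le].
  apply Req_le; f_equal; unfold Re, Cconj; simpl; ring.
- eapply Rle_lt_trans; [apply Cmod_triangle |].
  rewrite !Cmod_mult, !Cmod_conj.
  assert (q1 := Cmod_ge_0 (f w)); assert (q2 := Cmod_ge_0 (k w - k z)).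
  assert (q3 := Cmod_ge_0 (f w - f z)); unfold S in x2; nra.
Qed.

(** Only the differential equation and F 0 = 1 are kept from the series. The third derivative is
    there because the maximum principle asks for a differentiable g', and g' contains F''. *)
Lemma hypergeometric_equation_positive (a b c : C) (p : R)
  (F F1 F2 F3 : C -> C) :
  a + b + 1 - c = RtoC p ->
  (p < Re (a * b)%C)%R ->
  (0 <= condL a b c p)%R -> (0 <= condN a b c p)%R ->
  (0 <= condL a b c p * condN a b c p - condM a b ^ 2)%R ->
  F 0 = 1 ->
  (forall z, in_disk z -> cderiv F z (F1 z)) ->
  (forall z, in_disk z -> cderiv F1 z (F2 z)) ->
  (forall z, in_disk z -> cderiv F2 z (F3 z)) ->
  (forall z, in_disk z ->
     z * (1 - z) * F2 z + (c - (a + b + 1) * z) * F1 z - a * b * F z = 0) ->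
  forall z, in_disk z -> (0 < Re (Cconj (F z) * (F z + z * F1 z))%C)%R.
Proof.
intros hp hab hL hN hD hF0 hF hF1 hF2 hode z hz.
set (G := fun z => Re (Cconj (F z) * (F z + z * F1 z))).
apply Rnot_le_lt; intro hle.
assert (hGc : forall z, in_disk z -> forall eps, (0 < eps)%R -> exists d, (0 < d)%R /\
     forall w, (Cmod (w - z) < d)%R -> (Rabs (G w - G z) < eps)%R).
{ intros w hw eps he; unfold G.
  eapply (Re_conj_mul_continuous F (fun w => F w + w * F1 w)); [| | exact he].
  - apply hF; auto.
  - apply cderiv_plus; [apply hF; auto |].
    apply cderiv_mult; [apply cderiv_id | apply hF1; auto]. }
destruct (first_nonpositive_point G hGc) as (z0 & hz0 & hne & hG0 & hin & hbd).
{ unfold G; rewrite hF0; unfold Re, Cconj; simpl; lra. }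
{ exists z; auto. }
clear z hz hle.
unfold in_disk in *.
assert (hr := proj1 (Cmod_gt_0 _) hne).
assert (hFn : forall z, (Cmod z <= Cmod z0)%R -> F z <> 0).
{ apply (no_zero_on_first_circle F F1); auto.
  - intros z hz; apply hF; lra.
  - rewrite hF0; apply C1_nz. }
set (B := fun z => 2 * F z + z * F1 z).
set (B1 := fun z => 3 * F1 z + z * F2 z).
assert (hG : forall z, (Cmod z <= Cmod z0)%R -> (0 <= G z)%R).
{ intros z hz; destruct (Rle_lt_or_eq_dec _ _ hz); [left |]; auto. }
assert (hB2 : forall z, (Cmod (B z) ^ 2 = Cmod (z * F1 z) ^ 2 + 4 * G z)%R)
  by (intro z; apply Cmod2_add_twice).
(* As G >= 0, a zero of [B] would force z F' = 0 and then F = 0. *)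
assert (hBn : forall z, (Cmod z <= Cmod z0)%R -> B z <> 0).
{ intros z hz hB0; specialize (hG z hz); specialize (hB2 z).
  rewrite hB0, Cmod_0 in hB2.
  assert (q := Cmod_ge_0 (z * F1 z)).
  assert (h0 : z * F1 z = 0) by (apply Cmod_eq_0; nra).
  unfold B in hB0; rewrite h0 in hB0; apply (hFn z hz).
  replace (F z) with ((2 * F z + 0) / 2) by (field; injection; lra).
  rewrite hB0; field; injection; lra. }
set (g := fun z => - (1) * F1 z * / B z).
set (g1 := fun z => - (1) * (F2 z * B z + - (1) * (F1 z * B1 z)) * / (B z * B z)).
assert (hBd : forall z, (Cmod z < 1)%R -> cderiv B z (B1 z)).
{ intros z hz; eapply cderiv_eq.
  - apply cderiv_plus; apply cderiv_mult;
      [apply cderiv_const | apply hF | apply cderiv_id | apply hF1]; auto.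
  - unfold B1; simpl; ring. }
assert (hg : forall z, (Cmod z <= Cmod z0)%R ->
  cderiv g z (g1 z) /\ exists g2, cderiv g1 z g2).
{ intros z hz; assert (hz1 : (Cmod z < 1)%R) by lra; split.
  - eapply cderiv_eq.
    + apply cderiv_mult; [apply cderiv_mult; [apply cderiv_const | apply hF1; auto] |].
      apply cderiv_inv; auto.
    + unfold g1; simpl; field; auto.
  - eexists; apply cderiv_mult.
    + apply cderiv_mult; [apply cderiv_const |].
      apply cderiv_plus; [apply cderiv_mult; [apply hF2 | apply hBd]; auto |].
      apply cderiv_mult; [apply cderiv_const |].
      apply cderiv_mult; [apply hF1; auto |].
      apply cderiv_plus; apply cderiv_mult;
        [apply cderiv_const | apply hF1 | apply cderiv_id | apply hF2]; auto.
    + apply cderiv_inv; [apply cderiv_mult; apply hBd; auto |].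
      apply Cmult_neq_0; auto. }

(* That is, 4 G = (1 - |z g|^2) |B|^2: so |z g| <= 1 where G >= 0, with equality at [z0]. *)
assert (hgB : forall z, (Cmod z <= Cmod z0)%R ->
  ((Cmod z * Cmod (g z)) ^ 2 * Cmod (B z) ^ 2 + 4 * G z = Cmod (B z) ^ 2)%R).
{ intros z hz; rewrite hB2 at 2.
  rewrite <- Rpow_mult_distr, <- !Cmod_mult.
  replace (z * g z * B z) with (- (z * F1 z)) by (unfold g; field; auto).
  now rewrite Cmod_opp. }
assert (hgz0 : (Cmod z0 * Cmod (g z0) = 1)%R).
{ assert (h := hgB z0 (Rle_refl _)); rewrite hG0 in h.
  assert (q := proj1 (Cmod_gt_0 _) (hBn z0 (Rle_refl _))).
  assert (q' := Cmod_ge_0 (g z0)).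
  set (x := (Cmod z0 * Cmod (g z0))%R) in *.
  assert (0 <= x)%R by (apply Rmult_le_pos; lra).
  assert (x ^ 2 = 1)%R; [| nra].
  apply Rmult_eq_reg_r with (Cmod (B z0) ^ 2)%R; nra. }
assert (hgmax : forall z, (Cmod z <= Cmod z0)%R -> (Cmod (g z) <= Cmod (g z0))%R).
{ apply (maximum_modulus g g1 (Cmod z0)); auto; [apply Cmod_ge_0 |].
  intros z hz.
  assert (h := hgB z (Req_le _ _ hz)); rewrite hz in h.
  specialize (hbd z hz).
  assert (q := proj1 (Cmod_gt_0 _) (hBn z (Req_le _ _ hz))).
  apply Rmult_le_reg_l with (Cmod z0); auto; rewrite hgz0.
  assert (q' := Cmod_ge_0 (g z)).
  set (x := (Cmod z0 * Cmod (g z))%R) in *.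
  apply Rnot_lt_le; intro hx.
  assert (0 < Cmod (B z) ^ 2)%R by nra.
  assert (1 < x ^ 2)%R by nra; nra. }
destruct (boundary_maximum_modulus g z0 (g1 z0) hne) as (hk1 & hk2).
{ apply hg; lra. }
{ intros z hz; apply hgmax; lra. }
assert (hz1 : (Cmod z0 < 1)%R) by lra.
assert (hgp : (0 < Cmod (g z0) ^ 2)%R).
{ assert (Cmod (g z0) <> 0)%R by (intro e; rewrite e in hgz0; lra).
  assert (q := Cmod_ge_0 (g z0)); nra. }
set (k := Cconj (g z0) * (z0 * g1 z0)) in *.
(* Since [k] is real, this is z0 g'/g at [z0]. *)
set (zeta := (Re k / Cmod (g z0) ^ 2)%R).
assert (hzeta : (0 <= zeta)%R) by (apply Rle_mult_inv_pos; auto).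
assert (hk : k = RtoC (zeta * Cmod (g z0) ^ 2)).
{ replace (zeta * Cmod (g z0) ^ 2)%R with (Re k) by (unfold zeta, Rdiv; rewrite Rmult_assoc, Rinv_l; lra).
  apply injective_projections; [reflexivity | exact hk2]. }
assert (hFz := hFn z0 (Rle_refl _)); assert (hBz := hBn z0 (Rle_refl _)).
assert (hgz : g z0 <> 0) by (intro e; rewrite e, Cmod_0 in hgp; lra).
(* The relation zeta g = z0 g' with the denominators cleared, which brings in F''. *)
assert (hlog : RtoC zeta * F1 z0 * B z0 = z0 * (F2 z0 * B z0 - F1 z0 * B1 z0)).
{ assert (e : RtoC zeta * g z0 = z0 * g1 z0).
  { rewrite RtoC_mult, Cmod2_conj in hk; unfold k in hk.
    assert (hcg : Cconj (g z0) <> 0).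
    { apply Cmod_gt_0; rewrite Cmod_conj; now apply Cmod_gt_0. }
    replace (RtoC zeta * g z0) with (RtoC zeta * (g z0 * Cconj (g z0)) / Cconj (g z0))
      by (field; auto).
    rewrite <- hk; field; auto. }
  replace (RtoC zeta * F1 z0 * B z0) with (- (RtoC zeta * g z0) * (B z0 * B z0))
    by (unfold g; field; auto).
  rewrite e; unfold g1; field; auto. }
set (w := z0 * F1 z0 / F z0); set (v := z0 * z0 * F2 z0 / F z0).
assert (hw1 : Re w = (-1)%R).
{ assert (e : G z0 = (Cmod (F z0) ^ 2 * (1 + Re w))%R).
  { unfold G; replace (z0 * F1 z0) with (w * F z0) by (unfold w; field; auto).
    rewrite Cmod2_alt; unfold Re, Im, Cconj; simpl; ring. }
  rewrite hG0 in e; assert (q := proj1 (Cmod_gt_0 _) hFz).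
  assert (0 < Cmod (F z0) ^ 2)%R by nra.
  symmetry in e; apply Rmult_integral in e; lra. }
apply (no_boundary_solution a b c z0 v p (Im w) zeta); auto.
(* This is q^2 - 1 for q = i s. *)
- assert (e : w * (2 + w) = - RtoC (1 + Im w ^ 2)).
  { clearbody w; destruct w as (w1, w2); unfold Re in hw1; simpl in hw1; subst w1.
    apply injective_projections; simpl; ring. }
  replace (-1, Im w)%R with w
    by (rewrite <- hw1; apply injective_projections; reflexivity).
  rewrite RtoC_mult.
  replace (3 * (w * w) - RtoC zeta * RtoC (1 + Im w ^ 2))
    with (3 * (w * w) + RtoC zeta * (- RtoC (1 + Im w ^ 2))) by ring.
  rewrite <- e.
  replace (RtoC zeta * (w * (2 + w)))
    with (RtoC zeta * F1 z0 * B z0 * (z0 / (F z0 * F z0)))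
    by (unfold w, B; field; auto).
  rewrite hlog; unfold v, w, B, B1; field; auto.
- replace (-1, Im w)%R with w
    by (rewrite <- hw1; apply injective_projections; reflexivity).
  assert (e := hode z0 hz1).
  (* The differential equation multiplied by z0 / F z0. *)
  replace (v + c * w) with (z0 * (v + (a + b + 1) * w + a * b)
    + (z0 * (1 - z0) * F2 z0 + (c - (a + b + 1) * z0) * F1 z0 - a * b * F z0) * (z0 / F z0)).
  + rewrite e; ring.
  + unfold v, w; field; auto.
Qed.

(** * Hypergeometric coefficients *)

Lemma pochhammer_neq_0 (c : C) (n : nat) :
  (forall k : nat, c <> - RtoC (INR k)) -> pochhammer c n <> 0.
Proof.
intro hc; induction n as [| n IH]; simpl; [apply C1_nz |].
apply Cmult_neq_0; auto; intro e; apply (hc n).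
replace c with (c + RtoC (INR n) - RtoC (INR n)) by ring; rewrite e; ring.
Qed.

Lemma RtoC_INR_neq_0 (n : nat) : n <> 0%nat -> RtoC (INR n) <> 0.
Proof. intros hn e; apply RtoC_inj in e; now apply (not_0_INR n). Qed.

Lemma hyp2F1_coef_S (a b c : C) (n : nat) :
  (forall k : nat, c <> - RtoC (INR k)) ->
  RtoC (INR (S n)) * (c + RtoC (INR n)) * hyp2F1_coef a b c (S n)
  = (a + RtoC (INR n)) * (b + RtoC (INR n)) * hyp2F1_coef a b c n.
Proof.
intro hc; unfold hyp2F1_coef.
assert (h1 := pochhammer_neq_0 c n hc).
assert (h2 := pochhammer_neq_0 c (S n) hc); simpl in h2.
assert (h3 := RtoC_INR_neq_0 _ (fact_neq_0 n)).
assert (h4 := RtoC_INR_neq_0 (S n) ltac:(lia)).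
assert (h5 : c + RtoC (INR n) <> 0) by (intro e; apply h2; rewrite e; ring).
change (fact (S n)) with (S n * fact n)%nat; rewrite mult_INR, RtoC_mult.
cbn [pochhammer]; field; repeat split; assumption.
Qed.

Lemma eventually_nonincreasing_bounded (u : nat -> R) (N : nat) :
  (forall n, (N <= n)%nat -> (u (S n) <= u n)%R) ->
  exists M, forall n, (u n <= M)%R.
Proof.
intro h.
assert (h1 : forall k, exists M, forall n, (n <= k)%nat -> (u n <= M)%R).
{ induction k as [| k (M & IH)].
  - exists (u 0%nat); intros n hn; replace n with 0%nat by lia; lra.
  - exists (Rmax M (u (S k))); intros n hn.
    destruct (Nat.eq_dec n (S k)) as [-> | hne]; [apply Rmax_r |].
    eapply Rle_trans; [apply IH; lia | apply Rmax_l]. }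
destruct (h1 N) as (M & hM); exists M; intro n.
destruct (Nat.le_gt_cases n N) as [hn | hn]; auto.
induction n as [| n IH]; [lia |].
eapply Rle_trans; [apply h; lia |].
destruct (Nat.eq_dec n N) as [-> | hne]; [apply hM; lia | apply IH; lia].
Qed.

(** For r < 1 the sequence |A_n| r^n is eventually nonincreasing, because |a + n| |b + n| r <= (n +
    1) |c + n| for large n. It is therefore bounded, and the radius of convergence is at least r. *)
Lemma hyp2F1_coef_disk (a b c : C) :
  (forall k : nat, c <> - RtoC (INR k)) -> disk_coef (hyp2F1_coef a b c).
Proof.
intro hc; set (A := hyp2F1_coef a b c).
assert (hb : forall r, (0 < r < 1)%R -> exists M, forall n, (Cmod (A n) * r ^ n <= M)%R).
{ intros r hr.
  assert (pa := Cmod_ge_0 a); assert (pb := Cmod_ge_0 b); assert (pc := Cmod_ge_0 c).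
  set (K := (Cmod a + Cmod b + Cmod c + Cmod a * Cmod b)%R).
  assert (pab := Rmult_le_pos _ _ pa pb).
  (* Beyond this threshold K <= (n - 1 - |c|) (1 - r), which yields (|a| + n) (|b| + n) r <= (n + 1)
     (n - |c|). The floor lies below the threshold, hence the start at [S N]. *)
  destruct (nfloor_ex (1 + Cmod c + K / (1 - r))%R) as (N & hN).
  { assert (0 <= K / (1 - r))%R by (apply Rle_mult_inv_pos; unfold K; lra); lra. }
  apply (eventually_nonincreasing_bounded _ (S N)); intros n hn.
  assert (hn' : (1 + Cmod c + K / (1 - r) <= INR n)%R).
  { apply le_INR in hn; rewrite S_INR in hn; lra. }
  assert (hK : (0 <= K / (1 - r))%R) by (apply Rle_mult_inv_pos; unfold K; lra).
  assert (hx : (K <= (INR n - 1 - Cmod c) * (1 - r))%R)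
    by (apply Rle_div_l; lra).
  set (x := INR n) in *.
  assert (e := f_equal Cmod (hyp2F1_coef_S a b c n hc)).
  fold A in e; rewrite !Cmod_mult, Cmod_R, (Rabs_pos_eq _ (pos_INR _)), S_INR in e.
  fold x in e.
  assert (t1 : (Cmod (a + RtoC x) <= Cmod a + x)%R).
  { eapply Rle_trans; [apply Cmod_triangle |]; rewrite Cmod_R, Rabs_pos_eq; lra. }
  assert (t2 : (Cmod (b + RtoC x) <= Cmod b + x)%R).
  { eapply Rle_trans; [apply Cmod_triangle |]; rewrite Cmod_R, Rabs_pos_eq; lra. }
  assert (t3 : (x - Cmod c <= Cmod (c + RtoC x))%R).
  { assert (h := Cmod_triangle (c + RtoC x) (- c)).
    replace (c + RtoC x + - c) with (RtoC x) in h by ring.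
    rewrite Cmod_opp, Cmod_R, Rabs_pos_eq in h; lra. }
  assert (p1 := Cmod_ge_0 (A n)); assert (p2 := Cmod_ge_0 (A (S n))).
  assert (q1 : ((x + 1) * (x - Cmod c) * Cmod (A (S n))
     <= (Cmod a + x) * (Cmod b + x) * Cmod (A n))%R).
  { eapply Rle_trans with ((x + 1) * Cmod (c + RtoC x) * Cmod (A (S n)))%R.
    - apply Rmult_le_compat_r; auto; apply Rmult_le_compat_l; lra.
    - rewrite e; apply Rmult_le_compat_r; auto.
      apply Rmult_le_compat; auto; apply Cmod_ge_0. }
  assert (q2 : ((Cmod a + x) * (Cmod b + x) * r <= (x + 1) * (x - Cmod c))%R).
  { unfold K in hx.
    assert (1 <= x)%R by lra.
    assert (K1 : ((Cmod a + Cmod b + Cmod c + Cmod a * Cmod b) * x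
       <= (x - 1 - Cmod c) * (1 - r) * x)%R) by (apply Rmult_le_compat_r; lra).
    assert (r * (Cmod a * Cmod b) <= Cmod a * Cmod b * x)%R by nra.
    assert (r * (x * (Cmod a + Cmod b)) <= x * (Cmod a + Cmod b))%R.
    { assert (0 <= x * (Cmod a + Cmod b))%R by (apply Rmult_le_pos; lra); nra. }
    assert (0 <= Cmod c * x * (1 - r))%R
      by (apply Rmult_le_pos; [apply Rmult_le_pos |]; lra).
    nra. }
  assert (q3 : (0 < (x + 1) * (x - Cmod c))%R) by (apply Rmult_lt_0_compat; lra).
  assert (q4 : (r * Cmod (A (S n)) <= Cmod (A n))%R).
  { apply Rmult_le_reg_l with ((x + 1) * (x - Cmod c))%R; auto.
    apply Rle_trans with (r * ((Cmod a + x) * (Cmod b + x) * Cmod (A n)))%R; [nra |].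
    replace (r * ((Cmod a + x) * (Cmod b + x) * Cmod (A n)))%R
      with ((Cmod a + x) * (Cmod b + x) * r * Cmod (A n))%R by ring.
    apply Rmult_le_compat_r; auto. }
  simpl; assert (0 <= r ^ n)%R by (apply pow_le; lra); nra. }
destruct (CV_radius_bounded (fun n => Cmod (A n))) as (hub & _).
unfold disk_coef; fold A.
assert (hr : forall r, (0 < r < 1)%R -> Rbar_le r (CV_radius (fun n => Cmod (A n)))).
{ intros r hr; apply hub; destruct (hb r hr) as (M & hM); exists M; intro n.
  rewrite Rabs_pos_eq; auto.
  apply Rmult_le_pos; [apply Cmod_ge_0 | apply pow_le; lra]. }
destruct (CV_radius _) as [R0 | |]; simpl in *; auto.
- apply Rnot_lt_le; intro hlt.
  (* A radius below 1 but above [R0]; the entry 1/2 keeps it positive. *)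
  assert (h := hr (Rmax (1 / 2) ((R0 + 1) / 2))).
  assert (h1 := Rmax_r (1 / 2) ((R0 + 1) / 2)).
  assert (h2 := Rmax_l (1 / 2) ((R0 + 1) / 2)).
  assert (h3 : (Rmax (1 / 2) ((R0 + 1) / 2) < 1)%R) by (apply Rmax_lub_lt; lra).
  specialize (h ltac:(lra)); lra.
- apply (hr (1 / 2)%R); lra.
Qed.

(** The coefficient of z^n on the left is (n + 1) (c + n) A_(n+1) - (a + n) (b + n) A_n, which
    vanishes by the recurrence. *)
Lemma hypergeometric_equation (a b c z : C) :
  (forall k : nat, c <> - RtoC (INR k)) -> in_disk z ->
  let A := hyp2F1_coef a b c in
  z * (1 - z) * psum (dcoef (dcoef A)) z
  + (c - (a + b + 1) * z) * psum (dcoef A) z - a * b * psum A z = 0.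
Proof.
intros hc hz A.
assert (hA : disk_coef A) by (now apply hyp2F1_coef_disk).
assert (hA1 := disk_coef_dcoef _ hA); assert (hA2 := disk_coef_dcoef _ hA1).
assert (s0 := psum_correct _ _ hA hz).
assert (s1 := psum_correct _ _ hA1 hz).
assert (s2 := psum_correct _ _ hA2 hz).
assert (com : forall k : C, @mult C_AbsRing z k = @mult C_AbsRing k z)
  by (intro k; apply Cmult_comm).
(* Multiplication by z shifts the coefficients: once for z F'' and z F', twice for z^2 F''. *)
assert (t2 := is_pseries_incr_1 _ _ _ s2).
assert (t2' := is_pseries_incr_1 _ _ _ t2).
assert (t1 := is_pseries_incr_1 _ _ _ s1).
assert (u := is_pseries_plus _ _ _ _ _
  (is_pseries_plus _ _ _ _ _ t2 (is_pseries_scal (- (1) : C) _ _ _ (com _) t2'))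
  (is_pseries_plus _ _ _ _ _
    (is_pseries_plus _ _ _ _ _ (is_pseries_scal (c : C) _ _ _ (com _) s1)
       (is_pseries_scal (- (a + b + 1) : C) _ _ _ (com _) t1))
    (is_pseries_scal (- (a * b) : C) _ _ _ (com _) s0))).
(* The zero series, as 0 times F; uniqueness of sums will compare it with [u]. *)
assert (v := is_pseries_scal (RtoC 0) _ _ _ (com _) s0).
match type of u with is_pseries ?B _ ?l => assert (w : @is_pseries C_AbsRing C_NormedModule B z
  (@scal C_AbsRing C_NormedModule (RtoC 0) (psum A z))) end.
{ apply (is_pseries_ext (PS_scal (V := C_NormedModule) (RtoC 0) A)); [| exact v]; intro n; symmetry.
  transitivity (RtoC 0); [| symmetry; apply Cmult_0_l].
  assert (e := hyp2F1_coef_S a b c n hc); fold A in e.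
  unfold PS_plus, PS_scal, PS_incr_1, dcoef.
  match type of e with ?x = ?y => transitivity (x - y);
    [| rewrite e; apply (Cplus_opp_r y)] end.
  (* The shifts put zeros in the lowest places, so n = 0 and n = 1 are computed apart. *)
  destruct n as [| [| n]].
  - change (@eq C (0 + - (1) * 0 + (c * (RtoC 1 * A 1%nat) + - (a + b + 1) * 0
        + - (a * b) * A 0%nat))
      (RtoC 1 * (c + RtoC 0) * A 1%nat - (a + RtoC 0) * (b + RtoC 0) * A 0%nat)); ring.
  - change (@eq C (RtoC 1 * (RtoC (INR 2) * A 2%nat) + - (1) * 0
        + (c * (RtoC (INR 2) * A 2%nat) + - (a + b + 1) * (RtoC 1 * A 1%nat)
        + - (a * b) * A 1%nat))
      (RtoC (INR 2) * (c + RtoC 1) * A 2%nat - (a + RtoC 1) * (b + RtoC 1) * A 1%nat)).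
    ring.
  - set (x := RtoC (INR (S n))).
    assert (e2 : RtoC (INR (S (S n))) = x + 1)
      by (rewrite (S_INR (S n)), RtoC_plus; reflexivity).
    assert (e3 : RtoC (INR (S (S (S n)))) = x + 1 + 1)
      by (rewrite (S_INR (S (S n))), RtoC_plus, e2; reflexivity).
    change (@eq C (RtoC (INR (S (S n))) * (RtoC (INR (S (S (S n)))) * A (S (S (S n))))
        + - (1) * (x * (RtoC (INR (S (S n))) * A (S (S n))))
        + (c * (RtoC (INR (S (S (S n)))) * A (S (S (S n))))
           + - (a + b + 1) * (RtoC (INR (S (S n))) * A (S (S n)))
           + - (a * b) * A (S (S n))))
      (RtoC (INR (S (S (S n)))) * (c + RtoC (INR (S (S n)))) * A (S (S (S n)))
       - (a + RtoC (INR (S (S n)))) * (b + RtoC (INR (S (S n)))) * A (S (S n)))).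
    rewrite e3, e2; ring. }
match type of u with is_pseries _ _ ?l => set (x := l) in u end.
assert (hx : @eq C x (RtoC 0)).
{ transitivity (RtoC 0 * psum A z); [| apply Cmult_0_l].
  exact (filterlim_locally_unique (K := C_AbsRing) (V := C_NormedModule) _ _ _ u w). }
rewrite <- hx; unfold x; set (f2 := psum _ z); set (f1 := psum _ z); set (f0 := psum _ z).
match goal with |- ?l = ?y => change (@eq C l (z * f2 + - (1) * (z * (z * f2))
   + (c * f1 + - (a + b + 1) * (z * f1) + - (a * b) * f0))) end.
ring.
Qed.

(** * Starlikeness of the shifted hypergeometric function *)

Theorem theorem1p2 (a b c : C)
  (hab : a * b <> 0)
  (hc : forall n : nat, c <> - RtoC (INR n))
  (p : R)
  (hp : a + b + 1 - c = RtoC p)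
  (hre : (Re (a * b)%C > p)%R)
  (hL : (condL a b c p >= 0)%R)
  (hN : (condN a b c p >= 0)%R)
  (hLMN : (condL a b c p * condN a b c p - condM a b ^ 2 >= 0)%R) :
  starlike (fun z : C => z * hyp2F1 a b c z).
Proof.
set (A := hyp2F1_coef a b c).
change (starlike (fun z : C => z * psum A z)).
assert (hA : disk_coef A) by (now apply hyp2F1_coef_disk).
assert (hA1 := disk_coef_dcoef _ hA); assert (hA2 := disk_coef_dcoef _ hA1).
assert (hF0 : psum A 0 = 1).
{ rewrite psum_0; unfold A, hyp2F1_coef; simpl; field; apply C1_nz. }
assert (hd : forall z, in_disk z ->
  cderiv (fun z : C => z * psum A z) z (psum A z + z * psum (dcoef A) z)).
{ intros z hz; eapply cderiv_eq.
  - apply cderiv_mult; [apply cderiv_id | now apply psum_cderiv].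
  - cbv beta; ring. }
assert (hd' : forall z, in_disk z ->
  C_derive (fun z : C => z * psum A z) z = psum A z + z * psum (dcoef A) z).
{ intros z hz; apply is_C_derive_unique, cderiv_is_derive, hd, hz. }
assert (h0 : in_disk 0) by (unfold in_disk; rewrite Cmod_0; lra).
assert (hpos : forall z, in_disk z ->
  (0 < Re (Cconj (psum A z) * (psum A z + z * psum (dcoef A) z))%C)%R).
{ apply (hypergeometric_equation_positive a b c p (psum A) (psum (dcoef A))
    (psum (dcoef (dcoef A))) (psum (dcoef (dcoef (dcoef A))))); auto; try lra.
  - intros; now apply psum_cderiv.
  - intros; now apply psum_cderiv.
  - intros; now apply psum_cderiv.
  - intros; now apply hypergeometric_equation. }
(* At a zero of F the positive quantity of [hpos] would vanish. *)
assert (hn : forall z, in_disk z -> psum A z <> 0).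
{ intros z hz e; specialize (hpos z hz); rewrite e in hpos.
  unfold Re, Cconj in hpos; simpl in hpos; lra. }
repeat split.
- intros z hz; eexists; apply cderiv_is_derive, hd, hz.
- ring.
- rewrite hd', hF0 by exact h0; ring.
- intros z hz hz0; apply Cmult_neq_0; auto.
- intros z hz; unfold starlike_quotient.
  destruct (Ceq_dec z 0) as [_ | hz0]; [simpl; lra |].
  rewrite hd' by exact hz.
  specialize (hn z hz); specialize (hpos z hz).
  set (F := psum A z) in *; set (F1 := psum (dcoef A) z) in *.
  assert (q := proj1 (Cmod_gt_0 _) hn).
  (* For f = z F this says Re (conj F f') = |F|^2 Re (z f'/f), so positivity passes to the
     quotient. *)
  assert (e : (Re (Cconj F * (F + z * F1))%C
     = Cmod F ^ 2 * Re (z * (F + z * F1) / (z * F))%C)%R).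
  { rewrite Cmod2_alt.
    set (Q := z * (F + z * F1) / (z * F)).
    replace (F + z * F1) with (Q * F) by (unfold Q; field; auto).
    unfold Re, Im, Cconj; simpl; ring. }
  rewrite e in hpos.
  apply Rmult_lt_reg_l with (Cmod F ^ 2)%R; [nra | lra].
Qed.
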